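(* The following equation holds: $$\mathbb E\|\mathfrak P^{\perp}X\mathfrak P^{-1}\|_{\rm F}^2=d_\star\|\Lambda^{-1}\|_{\rm F}^2,$$ where $d_\star=d_1+d_2-2r$. Moreover, if $\lambda_r\ge C_1\sqrt{d_{\max}}$ for some large enough constant $C_1>0$, then $$\left|\mathbb E\,\mathrm{dist}^2[(\hat U,\hat V),(U,V)]-2d_\star\|\Lambda^{-1}\|_{\rm F}^2\right|\le C_2 r\left(\frac{d_{\max}}{\lambda_r^2}\right)^2,$$ where $C_2>0$ is an absolute constant (depending on the constant $C_1$).
   Context: Model: $M=U\Lambda V^{\mathsf T}\in\mathbb R^{d_1\times d_2}$ is a deterministic matrix of rank $r$, with $U\in\mathbb R^{d_1\times r}$, $V\in\mathbb R^{d_2\times r}$, $U^{\mathsf T}U=V^{\mathsf T}V=I_r$, and $\Lambda=\mathrm{diag}(\lambda_1,\dots,\lambda_r)$, $\lambda_1\ge\cdots\ge\lambda_r>0$. One observes $\hat M=M+Z$ where $Z\in\mathbb R^{d_1\times d_2}$ has i.i.d. $\mathcal N(0,1)$ entries. $\hat U,\hat V$ are the top-$r$ left and right singular vectors of $\hat M$, and $$\mathrm{dist}^2[(\hat U,\hat V),(U,V)]:=\|\hat U\hat U^{\mathsf T}-UU^{\mathsf T}\|_{\rm F}^2+\|\hat V\hat V^{\mathsf T}-VV^{\mathsf T}\|_{\rm F}^2 .$$ $d_{\max}=\max\{d_1,d_2\}$; $\|\cdot\|_{\rm F}$ is the Frobenius norm. Let $U_\perp,V_\perp$ be such that $(U,U_\perp)$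 and $(V,V_\perp)$ are orthogonal matrices, and set the $(d_1+d_2)\times(d_1+d_2)$ matrices $$X=\begin{pmatrix}0 & Z \\ Z^{\mathsf T} & 0\end{pmatrix},\quad \mathfrak P^{\perp}=\begin{pmatrix}U_\perp U_\perp^{\mathsf T} & 0 \\ 0 & V_\perp V_\perp^{\mathsf T}\end{pmatrix},\quad \mathfrak P^{-1}=\begin{pmatrix}0 & U\Lambda^{-1}V^{\mathsf T} \\ V\Lambda^{-1}U^{\mathsf T} & 0\end{pmatrix}.$$ Absolute constants do not depend on $d_1,d_2,r,U,V,\Lambda$. *)

(* Defs.v *)
From HB Require Import structures.
From mathcomp Require Import all_boot all_order all_algebra.
From mathcomp Require Import all_classical all_reals all_analysis.

Set Implicit Arguments.
Unset Strict Implicit.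
Unset Printing Implicit Defensive.

Import Order.TTheory GRing.Theory Num.Theory.
Import numFieldNormedType.Exports.

Local Open Scope classical_set_scope.
Local Open Scope ring_scope.

Definition frobenius (R : realType) (m n : nat) (A : 'M[R]_(m, n)) : R :=
  Num.sqrt (\sum_(i < m) \sum_(j < n) A i j ^+ 2).

(* Both identities are required: [Q] is typed as a rectangular matrix because
   the dimensions of [row_mx U Uperp] are only propositionally equal. *)
Definition orthogonal_mx (R : realType) (m n : nat) (Q : 'M[R]_(m, n)) : Prop :=
  Q^T *m Q = 1%:M /\ Q *m Q^T = 1%:M.

(* Thin SVD with [k] terms; some of the singular values may vanish. *)
Definition thin_svd (R : realType) (d1 d2 k : nat) (A : 'M[R]_(d1, d2))
    (U : 'M[R]_(d1, k)) (s : 'rV[R]_k) (V : 'M[R]_(d2, k)) : Prop :=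
  [/\ A = U *m diag_mx s *m V^T,
      U^T *m U = 1%:M,
      V^T *m V = 1%:M,
      (forall i j : 'I_k, (i <= j)%N -> s 0 j <= s 0 i) &
      (forall i : 'I_k, 0 <= s 0 i)].

(* Singular vectors are not unique, hence a relation: the pair [(Uhat, Vhat)]
   is formed by the leading [r] columns of some SVD of [A]. *)
Definition top_singular_vectors (R : realType) (d1 d2 r : nat)
    (A : 'M[R]_(d1, d2)) (Uhat : 'M[R]_(d1, r)) (Vhat : 'M[R]_(d2, r)) : Prop :=
  (r <= minn d1 d2)%N /\
  exists (U : 'M[R]_(d1, minn d1 d2)) (s : 'rV[R]_(minn d1 d2))
         (V : 'M[R]_(d2, minn d1 d2)),
    thin_svd A U s V /\
    forall (i : 'I_r) (j : 'I_(minn d1 d2)), i = j :> nat ->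
      col i Uhat = col j U /\ col i Vhat = col j V.

Definition dist2 (R : realType) (d1 d2 r : nat)
    (Uhat : 'M[R]_(d1, r)) (Vhat : 'M[R]_(d2, r))
    (U : 'M[R]_(d1, r)) (V : 'M[R]_(d2, r)) : R :=
  frobenius (Uhat *m Uhat^T - U *m U^T) ^+ 2 +
  frobenius (Vhat *m Vhat^T - V *m V^T) ^+ 2.

Definition low_rank_model (R : realType) (d1 d2 r : nat) (M : 'M[R]_(d1, d2))
    (U : 'M[R]_(d1, r)) (lam : 'rV[R]_r) (V : 'M[R]_(d2, r)) : Prop :=
  thin_svd M U lam V /\ forall i : 'I_r, 0 < lam 0 i.

Definition last_idx (r : nat) (hr : (0 < r)%N) : 'I_r :=
  Ordinal (etrans (ltn_predL r) hr).

Definition mutually_independent (R : realType) (d : measure_display)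
    (Omega : measurableType d) (P : probability Omega R) (I : finType)
    (X : I -> {RV P >-> R}) : Prop :=
  forall (J : {set I}) (B : I -> set R),
    (forall i, i \in J -> measurable (B i)) ->
    P (\bigcap_(i in [set i | i \in J]) (X i @^-1` B i)) =
    (\prod_(i in J) P (X i @^-1` B i))%E.

Definition iid_standard_normal (R : realType) (d : measure_display)
    (Omega : measurableType d) (P : probability Omega R) (I : finType)
    (X : I -> {RV P >-> R}) : Prop :=
  mutually_independent X /\
  forall (i : I) (B : set R), measurable B ->
    distribution P (X i) B = normal_prob 0 1 B.

Definition random_mx (R : realType) (d : measure_display)
    (Omega : measurableType d) (P : probability Omega R) (d1 d2 : nat)
    (Z : 'I_d1 * 'I_d2 -> {RV P >-> R}) (w : Omega) : 'M[R]_(d1, d2) :=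
  \matrix_(i, j) Z (i, j) w.

Definition dilation (R : realType) (d1 d2 : nat) (Z : 'M[R]_(d1, d2)) :
    'M[R]_(d1 + d2) :=
  block_mx 0 Z Z^T 0.

Definition frakP_perp (R : realType) (d1 d2 p q : nat)
    (Uperp : 'M[R]_(d1, p)) (Vperp : 'M[R]_(d2, q)) : 'M[R]_(d1 + d2) :=
  block_mx (Uperp *m Uperp^T) 0 0 (Vperp *m Vperp^T).

Definition frakP_inv (R : realType) (d1 d2 r : nat)
    (U : 'M[R]_(d1, r)) (lam : 'rV[R]_r) (V : 'M[R]_(d2, r)) :
    'M[R]_(d1 + d2) :=
  block_mx 0 (U *m invmx (diag_mx lam) *m V^T)
           (V *m invmx (diag_mx lam) *m U^T) 0.

Definition dstar (R : realType) (d1 d2 r : nat) : R :=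
  d1%:R + d2%:R - 2 * r%:R.

(* Main.v *)
Require Import Defs.
From HB Require Import structures.
From mathcomp Require Import all_boot all_order all_algebra.
From mathcomp Require Import all_classical all_reals all_analysis.
From mathcomp Require Import measurable_realfun ring lra.

Set Implicit Arguments.
Unset Strict Implicit.
Unset Printing Implicit Defensive.

Import Order.TTheory GRing.Theory Num.Theory.
Import numFieldNormedType.Exports.

Local Open Scope classical_set_scope.
Local Open Scope ring_scope.

(** Why the theorem holds. All matrices are lifted to size [d1 + d2] by the
    symmetric dilation. There, [P = block_proj U V] is the range projector of
    the dilation of [M], [T = frakP_inv U lam V] is its pseudo-inverse, [X] is
    the dilation of the noise, and the squared distance of the statement is the
    squared Frobenius distance between [P] and the projector [Ph] on the
    leading singular vectors of the noisy matrix.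

    The first identity is a computation of second moments: [(1 - P) X T] is
    block diagonal with blocks [Q1 Z S^T] and [Q2 Z^T S], where
    [Q1 = 1 - U U^T], [Q2 = 1 - V V^T] and [S = U Lambda^-1 V^T], and the mean
    of [|A Z B|^2] is [|A|^2 |B|^2] ([first_order_mean]).

    The second part is a deterministic expansion followed by an expectation. For
    every noise matrix with operator norm at most [s],
    [dist2 = 2 |F1|^2 + 4 <F1, F2> + O(r (s / lambda_r)^4)], where
    [F1 = (1 - P) X T] and [F2] is quadratic in the noise ([dist2_expansion]).
    The off-diagonal block of [Ph] solves a Sylvester equation whose iteration
    produces [F1] and [F2]; Weyl's inequalities, which single out the leading
    singular vectors, make the diagonal blocks of [Ph - P] quadratically small
    when [s <= lambda_r / 2] ([projector_expansion_small]). For larger [s]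
    every term is trivially of the order of the error
    ([projector_expansion_large]).

    In expectation, the quadratic term gives the announced value and the cubic
    term vanishes by symmetry. What remains is a bound [O(d_max^2)] for the
    fourth moment of the operator norm of a Gaussian matrix. It comes from a
    union bound over a grid discretisation of the unit balls, carried out on
    exponential moments ([spectral_bound_mean] and [spectral_bound_le]).

    Gaussian moments are all derived from the moment generating function:
    independence gives it for linear forms by a product formula
    ([integral_prod_indep]), its Taylor expansion gives the second and third
    moments of linear forms, and polarisation gives the mixed ones
    ([linform3_mean]). *)

(** * Frobenius norm and operator norm *)

Section frobenius_norm.
Context (R : realType).

Definition fip m n (A B : 'M[R]_(m, n)) : R := \tr (A^T *m B).

Lemma fipE m n (A B : 'M[R]_(m, n)) : fip A B = \sum_i \sum_j A i j * B i j.
Proof.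
rewrite /fip /mxtrace exchange_big; apply: eq_bigr => j _ /=.
by rewrite mxE; apply: eq_bigr => i _; rewrite mxE.
Qed.

Lemma fipC m n (A B : 'M[R]_(m, n)) : fip A B = fip B A.
Proof. by rewrite /fip -mxtrace_tr trmx_mul trmxK. Qed.

Lemma fipDl m n (A B C : 'M[R]_(m, n)) : fip (A + B) C = fip A C + fip B C.
Proof. by rewrite /fip linearD/= mulmxDl linearD. Qed.

Lemma fipDr m n (A B C : 'M[R]_(m, n)) : fip C (A + B) = fip C A + fip C B.
Proof. by rewrite fipC fipDl !(fipC _ C). Qed.

Lemma fipNl m n (A C : 'M[R]_(m, n)) : fip (- A) C = - fip A C.
Proof. by rewrite /fip linearN/= mulNmx linearN. Qed.

Lemma fipNr m n (A C : 'M[R]_(m, n)) : fip C (- A) = - fip C A.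
Proof. by rewrite fipC fipNl fipC. Qed.

Lemma fipZl m n a (A C : 'M[R]_(m, n)) : fip (a *: A) C = a * fip A C.
Proof. by rewrite /fip linearZ/= -scalemxAl linearZ. Qed.

Lemma fipZr m n a (A C : 'M[R]_(m, n)) : fip C (a *: A) = a * fip C A.
Proof. by rewrite fipC fipZl fipC. Qed.

Lemma frobenius_ge0 m n (A : 'M[R]_(m, n)) : 0 <= frobenius A.
Proof. exact: sqrtr_ge0. Qed.

Lemma sqr_frobenius m n (A : 'M[R]_(m, n)) : frobenius A ^+ 2 = fip A A.
Proof.
rewrite fipE /frobenius sqr_sqrtr; last first.
  by apply: sumr_ge0 => i _; apply: sumr_ge0 => j _; exact: sqr_ge0.
by apply: eq_bigr => i _; apply: eq_bigr => j _; rewrite expr2.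
Qed.

Lemma fip_ge0 m n (A : 'M[R]_(m, n)) : 0 <= fip A A.
Proof. by rewrite -sqr_frobenius sqr_ge0. Qed.

Lemma frobenius_le m n p q (A : 'M[R]_(m, n)) (B : 'M[R]_(p, q)) c : 0 <= c ->
  fip A A <= c ^+ 2 * fip B B -> frobenius A <= c * frobenius B.
Proof.
move=> c0; rewrite -!sqr_frobenius -exprMn ler_pXn2r ?nnegrE//.
  exact: frobenius_ge0.
by rewrite mulr_ge0// frobenius_ge0.
Qed.

Lemma frobenius_eq m n p q (A : 'M[R]_(m, n)) (B : 'M[R]_(p, q)) :
  fip A A = fip B B -> frobenius A = frobenius B.
Proof.
move=> AB; apply/eqP; rewrite -(@eqrXn2 _ 2) ?frobenius_ge0//.
by rewrite !sqr_frobenius AB.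
Qed.

(** The discriminant of the nonnegative quadratic [t |-> |A + t B|^2]; the
    minimiser [t = - <A, B> / |B|^2] is substituted directly. *)
Lemma fip_CauchySchwarz m n (A B : 'M[R]_(m, n)) :
  `|fip A B| <= frobenius A * frobenius B.
Proof.
rewrite -(@ler_pXn2r _ 2) ?nnegrE ?mulr_ge0 ?frobenius_ge0//.
rewrite real_normK ?num_real// exprMn !sqr_frobenius.
have B0 := fip_ge0 B.
have H t : 0 <= fip A A + 2 * t * fip A B + t ^+ 2 * fip B B.
  have := fip_ge0 (A + t *: B).
  by rewrite fipDl !fipDr !fipZl !fipZr (fipC B A); lra.
have [B1|B1] := eqVneq (fip B B) 0.
  rewrite B1 mulr0; have [->|AB] := eqVneq (fip A B) 0; first by rewrite expr0n.
  (* When [B] is null the quadratic degenerates to an affine function of [t],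
     which this [t] makes equal to -1. *)
  have := H (- (fip A A + 1) / (2 * fip A B)); rewrite B1 mulr0 addr0.
  have -> : 2 * (- (fip A A + 1) / (2 * fip A B)) * fip A B = - (fip A A + 1).
    by field.
  lra.
have Bp : 0 < fip B B by rewrite lt_def B1.
have := H (- fip A B / fip B B).
have -> : fip A A + 2 * (- fip A B / fip B B) * fip A B +
   (- fip A B / fip B B) ^+ 2 * fip B B = fip A A - fip A B ^+ 2 / fip B B.
  by field.
by rewrite subr_ge0 ler_pdivrMr.
Qed.

Lemma frobeniusD m n (A B : 'M[R]_(m, n)) :
  frobenius (A + B) <= frobenius A + frobenius B.
Proof.
rewrite -(@ler_pXn2r _ 2) ?nnegrE ?addr_ge0 ?frobenius_ge0//.
rewrite sqrrD !sqr_frobenius fipDl !fipDr (fipC B A).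
have := le_trans (ler_norm _) (fip_CauchySchwarz A B); lra.
Qed.

Lemma frobeniusN m n (A : 'M[R]_(m, n)) : frobenius (- A) = frobenius A.
Proof. by apply: frobenius_eq; rewrite fipNl fipNr opprK. Qed.

Lemma frobenius_trmx m n (A : 'M[R]_(m, n)) : frobenius A^T = frobenius A.
Proof. by apply: frobenius_eq; rewrite /fip trmxK mxtrace_mulC. Qed.

(** An upper bound on the operator norm, expressed through the only
    consequence of it that is needed: multiplying by [A] on either side
    inflates the Frobenius norm by at most [c]. In this form bounds for sums
    and products compose without suprema or singular values. *)
Definition opnorm_le m n (A : 'M[R]_(m, n)) (c : R) :=
  [/\ 0 <= c,
      forall p (B : 'M[R]_(n, p)), frobenius (A *m B) <= c * frobenius B &
      forall p (B : 'M[R]_(p, m)), frobenius (B *m A) <= c * frobenius B].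

Lemma opnorm_le_trmx m n (A : 'M[R]_(m, n)) c : opnorm_le A c -> opnorm_le A^T c.
Proof.
move=> [c0 Al Ar]; split=> // p B.
  by rewrite -frobenius_trmx trmx_mul trmxK -[frobenius B]frobenius_trmx.
by rewrite -frobenius_trmx trmx_mul trmxK -[frobenius B]frobenius_trmx.
Qed.

Lemma frobenius_mull m n p (A : 'M[R]_(m, n)) (B : 'M[R]_(n, p)) a b :
  opnorm_le A a -> frobenius B <= b -> frobenius (A *m B) <= a * b.
Proof.
by move=> [a0 Al _] Bb; apply: le_trans (Al _ _) _; rewrite ler_wpM2l.
Qed.

Lemma frobenius_mulr m n p (A : 'M[R]_(m, n)) (B : 'M[R]_(n, p)) a b :
  frobenius A <= a -> opnorm_le B b -> frobenius (A *m B) <= a * b.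
Proof.
move=> Aa [b0 _ Br]; apply: le_trans (Br _ _) _.
by rewrite mulrC ler_wpM2r.
Qed.

Lemma opnorm_leM m n p (A : 'M[R]_(m, n)) (B : 'M[R]_(n, p)) a b :
  opnorm_le A a -> opnorm_le B b -> opnorm_le (A *m B) (a * b).
Proof.
move=> Aa Bb; have [a0 _ _] := Aa; have [b0 Bl Br] := Bb.
split=> [|q C|q C]; first exact: mulr_ge0.
  by rewrite -mulmxA -mulrA; apply: frobenius_mull.
rewrite mulmxA (mulrC a b) -mulrA mulrC; apply: frobenius_mulr => //.
by case: Aa.
Qed.

Lemma opnorm_leD m n (A B : 'M[R]_(m, n)) a b :
  opnorm_le A a -> opnorm_le B b -> opnorm_le (A + B) (a + b).
Proof.
move=> [a0 Al Ar] [b0 Bl Br]; split=> [|q C|q C]; first exact: addr_ge0.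
  by rewrite mulmxDl mulrDl; apply: le_trans (frobeniusD _ _) _; rewrite lerD.
by rewrite mulmxDr mulrDl; apply: le_trans (frobeniusD _ _) _; rewrite lerD.
Qed.

Lemma opnorm_leN m n (A : 'M[R]_(m, n)) a : opnorm_le A a -> opnorm_le (- A) a.
Proof.
by move=> [a0 Al Ar]; split=> // q C; rewrite ?mulmxN ?mulNmx frobeniusN.
Qed.

(** Transposition turns right multiplication by [A] into left multiplication by
    its transpose. *)
Lemma opnorm_le_left m n (A : 'M[R]_(m, n)) c : 0 <= c ->
  (forall p (B : 'M[R]_(n, p)), frobenius (A *m B) <= c * frobenius B) ->
  (forall p (B : 'M[R]_(m, p)), frobenius (A^T *m B) <= c * frobenius B) ->
  opnorm_le A c.
Proof.
move=> c0 Al Atl; split=> // p B.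
by rewrite -frobenius_trmx trmx_mul -[frobenius B]frobenius_trmx.
Qed.

Definition orth_proj n (P : 'M[R]_n) := P^T = P /\ P *m P = P.

Lemma orth_projC n (P : 'M[R]_n) : orth_proj P -> orth_proj (1%:M - P).
Proof.
move=> [Pt PP]; split; first by rewrite linearB/= trmx1 Pt.
by rewrite mulmxBl mul1mx mulmxBr mulmx1 PP subrr subr0.
Qed.

Lemma fip_projl m n (P : 'M[R]_m) (B : 'M[R]_(m, n)) : orth_proj P ->
  fip (P *m B) (P *m B) = fip B (P *m B).
Proof.
by move=> [Pt PP]; rewrite /fip trmx_mul Pt -mulmxA (mulmxA P) PP.
Qed.

(** Pythagoras: [|B|^2 - |P B|^2] is the squared norm of [(1 - P) B]. *)
Lemma opnorm_le_proj n (P : 'M[R]_n) : orth_proj P -> opnorm_le P 1.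
Proof.
move=> Pp; have [Pt _] := Pp.
have Pl p (B : 'M[R]_(n, p)) : frobenius (P *m B) <= 1 * frobenius B.
  apply: frobenius_le => //; rewrite expr1n mul1r fip_projl//.
  rewrite -subr_ge0 -fipNr -fipDr.
  have -> : B - P *m B = (1%:M - P) *m B by rewrite mulmxBl mul1mx.
  by rewrite -fip_projl ?fip_ge0//; exact: orth_projC.
by apply: opnorm_le_left => // p B; rewrite Pt.
Qed.

Lemma orth_proj_isometry m n (U : 'M[R]_(m, n)) : U^T *m U = 1%:M ->
  orth_proj (U *m U^T).
Proof.
move=> UU; split; first by rewrite trmx_mul trmxK.
by rewrite mulmxA -(mulmxA U) UU mulmx1.
Qed.

Lemma fip_isometry m n p (U : 'M[R]_(m, n)) (B : 'M[R]_(n, p)) :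
  U^T *m U = 1%:M -> fip (U *m B) (U *m B) = fip B B.
Proof. by move=> UU; rewrite /fip trmx_mul -mulmxA (mulmxA U^T) UU mul1mx. Qed.

Lemma opnorm_le_isometry m n (U : 'M[R]_(m, n)) : U^T *m U = 1%:M -> opnorm_le U 1.
Proof.
move=> UU; apply: opnorm_le_left => // p B.
  by rewrite mul1r le_eqVlt (frobenius_eq (fip_isometry B UU)) eqxx.
rewrite -(frobenius_eq (fip_isometry (U^T *m B) UU)) mulmxA.
by have [_ + _] := opnorm_le_proj (orth_proj_isometry UU); apply.
Qed.

Lemma opnorm_le_diag n (s : 'rV[R]_n) c : 0 <= c -> (forall i, `|s 0 i| <= c) ->
  opnorm_le (diag_mx s) c.
Proof.
move=> c0 sc.
have Dl p (B : 'M[R]_(n, p)) : frobenius (diag_mx s *m B) <= c * frobenius B.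
  apply: frobenius_le => //; rewrite !fipE mulr_sumr; apply: ler_sum => i _.
  rewrite mulr_sumr; apply: ler_sum => j _; rewrite mul_diag_mx !mxE.
  rewrite mulrACA -!expr2 ler_wpM2r ?sqr_ge0//.
  by rewrite -[leLHS]real_normK ?num_real// lerXn2r ?nnegrE.
by apply: opnorm_le_left => // p B; rewrite tr_diag_mx.
Qed.

End frobenius_norm.

(** * Second order perturbation of projectors *)

(** Abstract perturbation of a spectral projector. [P] projects onto the range of
    [A], on which [T] inverts [A]; [X] is the perturbation; [Ph] is a projector
    commuting with [A + X], of the same rank as [P], and [Th] inverts [A + X]
    on its range. [l] bounds the operator norm of [T], [rho] is the
    square root of the common rank, and [e = s * l] measures the relative size
    of the perturbation. *)
Section perturbation.
Context (R : realType) (n : nat).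
Variables (A X P T Ph Th : 'M[R]_n).
Variables (s l rho : R).
Hypothesis Pproj : orth_proj P.
Hypothesis PA : P *m A = A.
Hypothesis AT : A *m T = P.
Hypothesis PT : P *m T = T.
Hypothesis Phproj : orth_proj Ph.
Hypothesis Ph_comm : Ph *m (A + X) = (A + X) *m Ph.
Hypothesis ATh : (A + X) *m Th = Ph.
Hypothesis trP : \tr P = rho ^+ 2.
Hypothesis trPh : \tr Ph = rho ^+ 2.
Hypothesis rho0 : 0 <= rho.
Hypothesis Xs : opnorm_le X s.
Hypothesis Tl : opnorm_le T l.
Hypothesis Tf : frobenius T <= l * rho.

Local Notation Q := (1%:M - P).
Local Notation Qh := (1%:M - Ph).
Local Notation e := (s * l).

(** The terms of degree 1 and 2 in [X] of the off-diagonal block [Q *m Ph *m P],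
    that is, of the solution of the Sylvester equation of [FE] below. *)
Definition first_order := Q *m X *m T.
Definition second_order := Q *m X *m first_order *m T - first_order *m X *m T.

Local Notation F1 := first_order.
Local Notation F2 := second_order.

Let PP : P *m P = P. Proof. exact: Pproj.2. Qed.
Let PhPh : Ph *m Ph = Ph. Proof. exact: Phproj.2. Qed.
Let Qproj : orth_proj Q. Proof. exact: orth_projC. Qed.
Let Qhproj : orth_proj Qh. Proof. exact: orth_projC. Qed.
Let s0 : 0 <= s. Proof. by case: Xs. Qed.
Let l0 : 0 <= l. Proof. by case: Tl. Qed.
Let e0 : 0 <= e. Proof. exact: mulr_ge0. Qed.
Let QA : Q *m A = 0. Proof. by rewrite mulmxBl mul1mx PA subrr. Qed.

Let QX : opnorm_le (Q *m X) s.
Proof. by rewrite -[s]mul1r; apply: opnorm_leM => //; exact: opnorm_le_proj. Qed.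

(** Both sides are [2 * (\tr Ph - \tr (P *m Ph))], because the traces agree. *)
Lemma dist_projE :
  frobenius (Ph - P) ^+ 2 = 2 * frobenius (Q *m Ph) ^+ 2.
Proof.
rewrite !sqr_frobenius fip_projl// /fip.
have [Pt _] := Pproj; have [Pht _] := Phproj.
rewrite !linearB/= Pht Pt !mulmxBl !mulmxBr mul1mx PP PhPh !linearB/=.
rewrite (mulmxA Ph P Ph) (mxtrace_mulC (Ph *m P) Ph) mulmxA PhPh.
by rewrite (mxtrace_mulC Ph P) trP trPh; ring.
Qed.

Let F1_le : frobenius F1 <= e * rho.
Proof. by rewrite -mulrA; exact: frobenius_mull. Qed.

Let F2_le : frobenius F2 <= 2 * e ^+ 2 * rho.
Proof.
apply: le_trans (frobeniusD _ _) _; rewrite frobeniusN.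
have h1 : frobenius (Q *m X *m F1 *m T) <= s * (e * rho) * l.
  by apply: frobenius_mulr => //; exact: frobenius_mull.
have h2 : frobenius (F1 *m X *m T) <= e * rho * s * l.
  by apply: frobenius_mulr => //; exact: frobenius_mulr.
apply: le_trans (lerD h1 h2) _; lra.
Qed.

(** For a perturbation that is not small, each of the three terms is already of
    the order of the right-hand side, since [e ^+ 2 >= 1 / 4]. *)
Lemma projector_expansion_large : 1 / 2 <= e ->
  `|frobenius (Ph - P) ^+ 2 - 2 * frobenius F1 ^+ 2 - 4 * fip F1 F2|
    <= 256 * rho ^+ 2 * e ^+ 4.
Proof.
move=> e2; rewrite dist_projE.
have h1 : frobenius (Q *m Ph) ^+ 2 <= rho ^+ 2.
  have -> : rho ^+ 2 = frobenius Ph ^+ 2.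
    by rewrite sqr_frobenius /fip Phproj.1 PhPh trPh.
  rewrite ler_pXn2r ?nnegrE ?frobenius_ge0//.
  by rewrite -[leRHS]mul1r; apply: frobenius_mull => //; exact: opnorm_le_proj.
have h2 : frobenius F1 ^+ 2 <= e ^+ 2 * rho ^+ 2.
  by rewrite -exprMn ler_pXn2r ?nnegrE ?mulr_ge0 ?frobenius_ge0.
have h3 : `|fip F1 F2| <= 2 * e ^+ 3 * rho ^+ 2.
  apply: le_trans (fip_CauchySchwarz _ _) _.
  have -> : 2 * e ^+ 3 * rho ^+ 2 = (e * rho) * (2 * e ^+ 2 * rho) by ring.
  by apply: ler_pM => //; exact: frobenius_ge0.
have g1 := sqr_ge0 (frobenius (Q *m Ph)); have g2 := sqr_ge0 (frobenius F1).
have r2 := sqr_ge0 rho.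
have e2' : 1 <= 4 * e ^+ 2 by nra.
have e3 : e ^+ 3 <= 2 * e ^+ 4.
  have -> : 2 * e ^+ 4 = 2 * e * e ^+ 3 by ring.
  by rewrite -[leLHS]mul1r ler_wpM2r ?exprn_ge0//; lra.
have e22 : e ^+ 2 <= 4 * e ^+ 4.
  have -> : 4 * e ^+ 4 = (4 * e ^+ 2) * e ^+ 2 by ring.
  by rewrite -[leLHS]mul1r ler_wpM2r ?sqr_ge0.
have k1 : rho ^+ 2 <= 16 * (rho ^+ 2 * e ^+ 4).
  have -> : 16 * (rho ^+ 2 * e ^+ 4) = (16 * e ^+ 4) * rho ^+ 2 by ring.
  by rewrite -[leLHS]mul1r ler_wpM2r//; lra.
have k2 : e ^+ 2 * rho ^+ 2 <= 4 * (rho ^+ 2 * e ^+ 4).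
  have -> : 4 * (rho ^+ 2 * e ^+ 4) = (4 * e ^+ 4) * rho ^+ 2 by ring.
  by rewrite ler_wpM2r.
have k3 : e ^+ 3 * rho ^+ 2 <= 2 * (rho ^+ 2 * e ^+ 4).
  have -> : 2 * (rho ^+ 2 * e ^+ 4) = (2 * e ^+ 4) * rho ^+ 2 by ring.
  by rewrite ler_wpM2r.
rewrite -(mulrA 256).
move: h3; rewrite ler_norml => /andP[h3 h3'].
rewrite ler_norml; apply/andP; split; lra.
Qed.

Hypothesis Thl : opnorm_le Th (2 * l).
Hypothesis Thf : frobenius Th <= 2 * l * rho.
Hypothesis QhAs : opnorm_le (Qh *m (A + X)) s.

Local Notation F := (Q *m Ph *m P).
Local Notation G := (Q *m Ph *m Q).
Local Notation H := (P *m Qh *m P).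
Local Notation E1 := (F - F1).

(** Because [Q] annihilates [A], only the noise survives in [Q *m (A + X)]. This
    makes [Q *m Ph] small, and hence the diagonal blocks [G] and [H] of [Ph - P]
    quadratically small. *)
Let QPhE : Q *m Ph = Q *m X *m Th.
Proof. by rewrite -{1}ATh mulmxA mulmxDr QA add0r. Qed.

Let QPh_op : opnorm_le (Q *m Ph) (2 * e).
Proof. by rewrite QPhE mulrCA; exact: opnorm_leM. Qed.

Let QPh_le : frobenius (Q *m Ph) <= 2 * e * rho.
Proof.
rewrite QPhE (_ : 2 * e * rho = s * (2 * l * rho)); last by ring.
exact: frobenius_mull.
Qed.

Let F_le : frobenius F <= 2 * e * rho.
Proof.
by rewrite -[leRHS]mulr1; apply: frobenius_mulr => //; exact: opnorm_le_proj.
Qed.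

Let GE : G = (Q *m Ph) *m (Q *m Ph)^T.
Proof.
by rewrite trmx_mul Qproj.1 Phproj.1 mulmxA -(mulmxA Q Ph Ph) PhPh.
Qed.

Let G_le : frobenius G <= 4 * e ^+ 2 * rho.
Proof.
rewrite GE (_ : 4 * e ^+ 2 * rho = 2 * e * (2 * e * rho)); last by ring.
by apply: frobenius_mull => //; rewrite frobenius_trmx.
Qed.

(** Dual to [QPhE], with the roles of the two projectors exchanged; [A + X] is
    not annihilated by [Qh], whence the hypothesis [QhAs]. It makes the other
    diagonal block, [- H], quadratically small. *)
Let QhP_op : opnorm_le (Qh *m P) (2 * e).
Proof.
have -> : Qh *m P = Qh *m (A + X) *m T - Qh *m X *m T.
  by rewrite -mulmxBl -mulmxBr addrK -mulmxA AT.
rewrite (_ : 2 * e = e + 1 * s * l); last by ring.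
apply: opnorm_leD; first exact: opnorm_leM.
apply: opnorm_leN; apply: opnorm_leM => //; apply: opnorm_leM => //.
exact: opnorm_le_proj.
Qed.

Let H_op : opnorm_le H (4 * e ^+ 2).
Proof.
have -> : H = (Qh *m P)^T *m (Qh *m P).
  by rewrite trmx_mul Qhproj.1 Pproj.1 mulmxA -(mulmxA P Qh Qh) Qhproj.2.
rewrite (_ : 4 * e ^+ 2 = 2 * e * (2 * e)); last by ring.
by apply: opnorm_leM => //; exact: opnorm_le_trmx.
Qed.

(** The equation behind the expansion. From [A *m T = P] and the commutation of
    [Ph] with [A + X] one gets [F = (Q X Ph - Q Ph X) T]; splitting [Ph] into
    its four blocks relative to [P] isolates the first order term, and every
    remaining term has degree at least 2. *)
Let FE : E1 = Q *m X *m F *m T - F *m X *m T - Q *m X *m H *m T - G *m X *m T.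
Proof.
have h1 : F = Q *m X *m Ph *m T - Q *m Ph *m X *m T.
  rewrite -{2}AT mulmxA -(mulmxA Q Ph A).
  have -> : Ph *m A = (A + X) *m Ph - Ph *m X.
    by rewrite -Ph_comm -mulmxBr addrK.
  by rewrite mulmxBr mulmxBl !mulmxA mulmxDr QA add0r.
have h2 : Ph *m T = F *m T + T - H *m T.
  rewrite -(mulmxA _ P T) PT -(mulmxA _ P T) PT.
  rewrite !mulmxBl !mulmxBr !mulmxBl !mulmx1 !mul1mx PT.
  by apply/matrixP => i j; rewrite !mxE; ring.
have h3 : Q *m Ph *m X *m T = F *m X *m T + G *m X *m T.
  by rewrite -!mulmxDl -mulmxDr [P + _]addrC subrK mulmx1.
rewrite {1}h1 h3 -(mulmxA (Q *m X) Ph T) h2 (mulmxBr (Q *m X)) (mulmxDr (Q *m X)).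
rewrite (mulmxA (Q *m X) F T) (mulmxA (Q *m X) H T) -/F1.
move: (_ *m F *m T) (_ *m H *m T) (F *m X *m T) (G *m X *m T) F1 => a b c f g.
by apply/matrixP => i j; rewrite !mxE; ring.
Qed.

Let triangle4 (a b c d : 'M[R]_n) : frobenius (a - b - c - d) <=
  frobenius a + frobenius b + frobenius c + frobenius d.
Proof.
have tri (u v : 'M[R]_n) : frobenius (u - v) <= frobenius u + frobenius v.
  by apply: le_trans (frobeniusD _ _) _; rewrite frobeniusN.
apply: le_trans (tri _ _) _; rewrite lerD2r.
by apply: le_trans (tri _ _) _; rewrite lerD2r.
Qed.

Let XHT_le : frobenius (Q *m X *m H *m T) <= 4 * e ^+ 3 * rho.
Proof.
rewrite (_ : 4 * e ^+ 3 * rho = s * (4 * e ^+ 2) * (l * rho)); last by ring.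
by apply: frobenius_mull => //; exact: opnorm_leM.
Qed.

Let GXT_le : frobenius (G *m X *m T) <= 4 * e ^+ 3 * rho.
Proof.
rewrite (_ : 4 * e ^+ 3 * rho = 4 * e ^+ 2 * rho * s * l); last by ring.
by apply: frobenius_mulr => //; exact: frobenius_mulr.
Qed.

Let E1_le : e <= 1 / 2 -> frobenius E1 <= 8 * e ^+ 2 * rho.
Proof.
move=> e2; rewrite FE; apply: le_trans (triangle4 _ _ _ _) _.
have h1 : frobenius (Q *m X *m F *m T) <= s * (2 * e * rho) * l.
  by apply: frobenius_mulr => //; exact: frobenius_mull.
have h2 : frobenius (F *m X *m T) <= 2 * e * rho * s * l.
  by apply: frobenius_mulr => //; exact: frobenius_mulr.
apply: le_trans (lerD (lerD (lerD h1 h2) XHT_le) GXT_le) _.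
have : e ^+ 2 * rho * e <= e ^+ 2 * rho * (1 / 2).
  by rewrite ler_wpM2l// mulr_ge0// sqr_ge0.
lra.
Qed.

(** Subtracting [second_order] replaces [F] by [E1] in the two quadratic terms of
    [FE], which gains one more power of [e]. *)
Let rem_le : e <= 1 / 2 -> frobenius (E1 - F2) <= 24 * e ^+ 3 * rho.
Proof.
move=> e2.
have -> : E1 - F2 =
    Q *m X *m E1 *m T - E1 *m X *m T - Q *m X *m H *m T - G *m X *m T.
  rewrite {1}FE /second_order (mulmxBr (Q *m X)) !(mulmxBl F F1) !(mulmxBl _ _ T).
  move: (Q *m X *m F *m T) (Q *m X *m F1 *m T) (_ *m H *m T) (G *m X *m T).
  move: (F *m X *m T) (F1 *m X *m T) => a b c d f g.
  by apply/matrixP => i j; rewrite !mxE; ring.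
apply: le_trans (triangle4 _ _ _ _) _.
have h1 : frobenius (Q *m X *m E1 *m T) <= s * (8 * e ^+ 2 * rho) * l.
  by apply: frobenius_mulr => //; apply: frobenius_mull => //; exact: E1_le.
have h2 : frobenius (E1 *m X *m T) <= 8 * e ^+ 2 * rho * s * l.
  by apply: frobenius_mulr => //; apply: frobenius_mulr => //; exact: E1_le.
apply: le_trans (lerD (lerD (lerD h1 h2) XHT_le) GXT_le) _; lra.
Qed.

(** The blocks [F] and [G] have orthogonal row spaces. *)
Let QPh_split : frobenius (Q *m Ph) ^+ 2 = frobenius F ^+ 2 + frobenius G ^+ 2.
Proof.
rewrite !sqr_frobenius.
have QPhFG : Q *m Ph = F + G by rewrite -mulmxDr [P + _]addrC subrK mulmx1.
have FG : fip F G = 0.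
  rewrite /fip mxtrace_mulC trmx_mul Pproj.1 mulmxA -(mulmxA _ Q P).
  have -> : Q *m P = 0 by rewrite mulmxBl mul1mx PP subrr.
  by rewrite mulmx0 mul0mx linear0.
by rewrite [in LHS]QPhFG fipDl !fipDr FG (fipC G F) FG addr0 add0r.
Qed.

(** With [dist_projE] and [QPh_split], the squared distance is
    [2 * (|F|^2 + |G|^2)]. Expanding [F = F1 + F2 + (E1 - F2)], the terms other
    than [|F1|^2] and [2 <F1, F2>] have order [e ^+ 4]. All errors are measured
    in Frobenius norm on one factor only, so that [rho ^+ 2] appears once. *)
Lemma projector_expansion_small : e <= 1 / 2 ->
  `|frobenius (Ph - P) ^+ 2 - 2 * frobenius F1 ^+ 2 - 4 * fip F1 F2|
    <= 256 * rho ^+ 2 * e ^+ 4.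
Proof.
move=> e2; rewrite dist_projE QPh_split.
have FF : frobenius F ^+ 2 = frobenius F1 ^+ 2 + 2 * fip F1 F2 +
    2 * fip F1 (E1 - F2) + frobenius E1 ^+ 2.
  have FS : F = F1 + E1 by rewrite addrCA subrr addr0.
  rewrite !sqr_frobenius; move: E1 FS => D ->; move: F1 F2 => f g.
  by rewrite !fipDr !fipDl (fipC D f) fipNr; ring.
have h1 : `|fip F1 (E1 - F2)| <= 24 * (rho ^+ 2 * e ^+ 4).
  apply: le_trans (fip_CauchySchwarz _ _) _.
  have -> : 24 * (rho ^+ 2 * e ^+ 4) = (e * rho) * (24 * e ^+ 3 * rho) by ring.
  by apply: ler_pM => //; [exact: frobenius_ge0|exact: frobenius_ge0|exact: rem_le].
have sq (u v : R) : 0 <= u -> u <= v -> u ^+ 2 <= v ^+ 2.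
  by move=> u0 uv; rewrite ler_pXn2r ?nnegrE// (le_trans u0).
have h2 : frobenius E1 ^+ 2 <= 64 * (rho ^+ 2 * e ^+ 4).
  have -> : 64 * (rho ^+ 2 * e ^+ 4) = (8 * e ^+ 2 * rho) ^+ 2 by ring.
  by apply: sq; [exact: frobenius_ge0|exact: E1_le].
have h3 : frobenius G ^+ 2 <= 16 * (rho ^+ 2 * e ^+ 4).
  have -> : 16 * (rho ^+ 2 * e ^+ 4) = (4 * e ^+ 2 * rho) ^+ 2 by ring.
  by apply: sq => //; exact: frobenius_ge0.
have g2 := sqr_ge0 (frobenius E1); have g3 := sqr_ge0 (frobenius G).
rewrite FF -(mulrA 256).
have -> : 2 * (frobenius F1 ^+ 2 + 2 * fip F1 F2 + 2 * fip F1 (E1 - F2) +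
    frobenius E1 ^+ 2 + frobenius G ^+ 2) - 2 * frobenius F1 ^+ 2 - 4 * fip F1 F2
  = 4 * fip F1 (E1 - F2) + 2 * frobenius E1 ^+ 2 + 2 * frobenius G ^+ 2 by ring.
move: h1; rewrite !ler_norml => /andP[h1 h1'].
apply/andP; split; lra.
Qed.

End perturbation.

(** * Bilinear forms and discretisation of the unit ball *)

Section bilinear.
Context (R : realType).

Definition sqnorm m (x : 'I_m -> R) : R := \sum_i x i ^+ 2.

Definition bil m1 m2 (A : 'M[R]_(m1, m2)) (x : 'I_m1 -> R) (y : 'I_m2 -> R) : R :=
  \sum_i \sum_j x i * A i j * y j.

Lemma sqnorm_ge0 m (x : 'I_m -> R) : 0 <= sqnorm x.
Proof. by apply: sumr_ge0 => i _; exact: sqr_ge0. Qed.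

Lemma bilBl m1 m2 (A : 'M[R]_(m1, m2)) x x' y :
  bil A (fun i => x i - x' i) y = bil A x y - bil A x' y.
Proof.
rewrite /bil -sumrB; apply: eq_bigr => i _; rewrite -sumrB.
by apply: eq_bigr => j _; rewrite !mulrBl.
Qed.

Lemma bilBr m1 m2 (A : 'M[R]_(m1, m2)) x y y' :
  bil A x (fun i => y i - y' i) = bil A x y - bil A x y'.
Proof.
rewrite /bil -sumrB; apply: eq_bigr => i _; rewrite -sumrB.
by apply: eq_bigr => j _; rewrite mulrBr.
Qed.

Lemma bilZl m1 m2 (A : 'M[R]_(m1, m2)) c x y :
  bil A (fun i => c * x i) y = c * bil A x y.
Proof.
rewrite /bil mulr_sumr; apply: eq_bigr => i _; rewrite mulr_sumr.
by apply: eq_bigr => j _; rewrite !mulrA.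
Qed.

Lemma bilZr m1 m2 (A : 'M[R]_(m1, m2)) c x y :
  bil A x (fun i => c * y i) = c * bil A x y.
Proof.
rewrite /bil mulr_sumr; apply: eq_bigr => i _; rewrite mulr_sumr.
by apply: eq_bigr => j _; ring.
Qed.

Lemma sqnormZ m c (x : 'I_m -> R) : sqnorm (fun i => c * x i) = c ^+ 2 * sqnorm x.
Proof. by rewrite /sqnorm mulr_sumr; apply: eq_bigr => i _; rewrite exprMn. Qed.

Lemma sqnorm_coord m (x : 'I_m -> R) i : x i ^+ 2 <= sqnorm x.
Proof.
rewrite /sqnorm (bigD1 i)//= lerDl.
by apply: sumr_ge0 => j _; exact: sqr_ge0.
Qed.

(** The operator norm bound in its variational form, the one suited to a union
    bound over test vectors. *)
Definition spectral_le m1 m2 (A : 'M[R]_(m1, m2)) (s : R) :=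
  forall x y, sqnorm x <= 1 -> sqnorm y <= 1 -> bil A x y <= s.

Lemma bil_bounded m1 m2 (A : 'M[R]_(m1, m2)) :
  spectral_le A (\sum_i \sum_j `|A i j|).
Proof.
have le1 m (x : 'I_m -> R) i : sqnorm x <= 1 -> `|x i| <= 1.
  move=> x1; rewrite -(@ler_pXn2r _ 2) ?nnegrE//.
  rewrite real_normK ?num_real// expr1n.
  exact: le_trans (sqnorm_coord x i) x1.
move=> x y x1 y1; apply: ler_sum => i _; apply: ler_sum => j _.
apply: le_trans (ler_norm _) _; rewrite !normrM.
apply: (@le_trans _ _ (`|x i| * `|A i j|)).
  by apply: ler_piMr; [rewrite mulr_ge0|exact: le1].
by apply: ler_piMl => //; exact: le1.
Qed.

(** Approximating both vectors to within 1/4 bounds the supremum [S] of the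
    bilinear form over the unit balls by [h + S / 4 + S / 4]; solving for [S],
    which is finite, gives [2 * h]. *)
Lemma spectral_le_net m1 m2 (A : 'M[R]_(m1, m2))
    (N1 : set ('I_m1 -> R)) (N2 : set ('I_m2 -> R)) (h : R) :
  (forall x, N1 x -> sqnorm x <= 1) -> (forall y, N2 y -> sqnorm y <= 1) ->
  (forall u, sqnorm u <= 1 ->
     exists2 x, N1 x & sqnorm (fun i => u i - x i) <= 16^-1) ->
  (forall v, sqnorm v <= 1 ->
     exists2 y, N2 y & sqnorm (fun i => v i - y i) <= 16^-1) ->
  (forall x y, N1 x -> N2 y -> bil A x y <= h) ->
  spectral_le A (2 * h).
Proof.
move=> N11 N21 net1 net2 Ah.
pose E := [set t : R |
  exists x y, [/\ sqnorm x <= 1, sqnorm y <= 1 & t = bil A x y]].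
have z1 m : sqnorm (fun _ : 'I_m => 0) <= 1.
  by rewrite /sqnorm big1// => i _; rewrite expr0n.
have supE : has_sup E.
  split; first by exists (bil A (fun=> 0) (fun=> 0)), (fun=> 0), (fun=> 0).
  by exists (\sum_i \sum_j `|A i j|) => t [x [y [x1 y1 ->]]]; exact: bil_bounded.
have le_sup x y : sqnorm x <= 1 -> sqnorm y <= 1 -> bil A x y <= sup E.
  by move=> x1 y1; apply: sup_upper_bound => //; exists x, y.
suff supEh : sup E <= h + sup E / 2.
  by move=> x y x1 y1; apply: le_trans (le_sup _ _ x1 y1) _; lra.
apply: ge_sup; first by case: supE.
move=> _ [u [v [u1 v1 ->]]].
have [x Nx ux] := net1 u u1; have [y Ny vy] := net2 v v1.
have small m (z : 'I_m -> R) : sqnorm z <= 16^-1 -> sqnorm (fun i => 4 * z i) <= 1.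
  by rewrite sqnormZ; lra.
have := le_sup _ _ (small _ _ ux) v1; rewrite bilZl bilBl => h1.
have := le_sup _ _ (N11 _ Nx) (small _ _ vy); rewrite bilZr bilBr => h2.
have h3 := Ah _ _ Nx Ny.
lra.
Qed.

End bilinear.

Section grid.
Context (R : realType) (m : nat).

Notation code := {ffun 'I_m -> bool * 'I_(4 * m).+1}.

(** A code lists signs and magnitudes of integer coordinates, in units of
    [1 / (4 * sqrt m)]. *)
Definition grid_point (k : code) (i : 'I_m) : R :=
  (-1) ^+ (k i).1 * (k i).2%:R / (4 * Num.sqrt m%:R).

(** [2] to the minus l1-norm of the integer coordinates. These weights replace
    an estimate of the cardinality of the net: their total is a product of
    geometric sums, while each useful grid point has weight at least
    [2 ^- (4 * m)]. *)
Definition grid_weight (k : code) : R := \prod_i 2^-1 ^+ (k i).2.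

Lemma grid_weight_gt0 k : 0 < grid_weight k.
Proof. by apply: prodr_gt0 => i _; rewrite exprn_gt0. Qed.

Lemma sum_grid_weight : \sum_k grid_weight k <= 4 ^+ m.
Proof.
rewrite /grid_weight -(bigA_distr_bigA (fun (_ : 'I_m) (p : bool * 'I_(4 * m).+1) =>
  2^-1 ^+ p.2 : R)).
rewrite -[4]/(4 : R) -[X in _ <= _ ^+ X]card_ord -prodr_const.
apply: ler_prod => i _; apply/andP; split.
  by apply: sumr_ge0 => p _; rewrite exprn_ge0.
rewrite -(pair_bigA_idem _ (fun (_ : bool) (j : 'I_(4 * m).+1) => 2^-1 ^+ j : R))/=;
  last by rewrite addr0.
rewrite big_bool /=.
have H n : \sum_(j < n) 2^-1 ^+ j + 2 * 2^-1 ^+ n = 2 :> R.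
  elim: n => [|n IHn]; first by rewrite big_ord0 add0r mulr1.
  by rewrite big_ord_recr /= exprS; lra.
have := H (4 * m).+1.
have : (0 : R) <= 2^-1 ^+ (4 * m).+1 by rewrite exprn_ge0.
lra.
Qed.

(** Round each coordinate towards zero: norms do not increase, the error is at most
    [1 / (4 * sqrt m)] per coordinate, and the l1-norm of the integer vector is
    at most [4 * sqrt m] times that of [v], hence at most [4 * m]. *)
Lemma grid_net (v : 'I_m -> R) : sqnorm v <= 1 ->
  exists k, [/\ sqnorm (grid_point k) <= 1,
    2^-1 ^+ (4 * m) <= grid_weight k &
    sqnorm (fun i => v i - grid_point k i) <= 16^-1].
Proof.
move=> v1; set q := Num.sqrt (m%:R : R).
have q0 : 0 <= q by exact: sqrtr_ge0.
have qq : q ^+ 2 = m%:R by rewrite sqr_sqrtr.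
pose t i := Num.truncn (4 * q * `|v i|).
have t0 i : 0 <= 4 * q * `|v i| by rewrite !mulr_ge0.
have tle i : (t i)%:R <= 4 * q * `|v i| by rewrite Num.Theory.truncn_le.
have tgt i : 4 * q * `|v i| < (t i).+1%:R by exact: Num.Theory.truncnS_gt.
have ltm i : (t i < (4 * m).+1)%N.
  rewrite ltnS -(ler_nat R); apply: le_trans (tle i) _.
  have m1 : 1 <= q.
    rewrite -sqrtr1 ler_wsqrtr// ler1n; exact: leq_ltn_trans (leq0n i) (ltn_ord i).
  have vi : `|v i| <= 1.
    rewrite -(@ler_pXn2r _ 2) ?nnegrE// real_normK ?num_real// expr1n.
    exact: le_trans (sqnorm_coord v i) v1.
  rewrite natrM -qq -mulrA ler_wpM2l// expr2 ler_wpM2l//.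
  exact: le_trans m1.
pose k : code := [ffun i => (v i < 0, Ordinal (ltm i))].
exists k.
have qpos : (0 < m)%N -> 0 < q by move=> m0; rewrite sqrtr_gt0 ltr0n.
have xE i : grid_point k i = (-1) ^+ (v i < 0)%R * ((t i)%:R / (4 * q)).
  by rewrite /grid_point ffunE /= mulrA.
have vE i : v i = (-1) ^+ (v i < 0)%R * `|v i| by rewrite -numEsign.
split.
- apply: le_trans v1; apply: ler_sum => i _.
  rewrite xE exprMn sqrr_sign mul1r -[leRHS]real_normK ?num_real//.
  have qi := qpos (leq_ltn_trans (leq0n i) (ltn_ord i)).
  rewrite ler_pXn2r ?nnegrE ?divr_ge0 ?mulr_ge0//.
  by rewrite ler_pdivrMr ?mulr_gt0// mulrC.
- rewrite /grid_weight; under eq_bigr do rewrite ffunE /=.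
  rewrite -expr_sum; apply: ler_wiXn2l; rewrite ?invr_ge0 ?invf_le1 ?ler1n//.
  rewrite -(ler_nat R) natr_sum.
  apply: (@le_trans _ _ (\sum_i (2 * (1 + m%:R * v i ^+ 2)))).
    apply: ler_sum => i _; apply: le_trans (tle i) _.
    rewrite -(real_normK (num_real (v i))) -qq.
    (* [4 q |v i| <= 2 (1 + q^2 |v i|^2)] is the arithmetic-geometric inequality. *)
    have := sqr_ge0 (q * `|v i| - 1); nra.
  rewrite -mulr_sumr big_split /= sumr_const card_ord -mulr_sumr -/(sqnorm v).
  rewrite natrM.
  have : m%:R * sqnorm v <= m%:R * 1 by rewrite ler_wpM2l.
  lra.
- apply: (@le_trans _ _ (\sum_(i < m) (16^-1 / m%:R))).
    apply: ler_sum => i _; rewrite {1}vE xE -mulrBr exprMn sqrr_sign mul1r -qq.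
    have qi := qpos (leq_ltn_trans (leq0n i) (ltn_ord i)).
    have -> : `|v i| - (t i)%:R / (4 * q) = (4 * q * `|v i| - (t i)%:R) / (4 * q).
      by field; rewrite gt_eqF.
    rewrite expr_div_n -[leRHS]mul1r.
    have -> : 1 * (16^-1 / q ^+ 2) = 1 / (4 * q) ^+ 2 by field; rewrite gt_eqF.
    rewrite ler_wpM2r ?invr_ge0 ?exprn_ge0 ?mulr_ge0//.
    have := tle i; have := tgt i; rewrite -natr1.
    by move=> h1 h2; apply: exprn_ile1; lra.
  rewrite sumr_const card_ord -[leLHS]mulr_natr.
  have [m0|m0] := posnP m; first by rewrite [in X in _ * X]m0 mulr0 invr_ge0.
  by rewrite divfK// pnatr_eq0 -lt0n.
Qed.
End grid.

Section spectral_opb.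
Context (R : realType).

Lemma fip_col_sqnorm m n (A : 'M[R]_(m, n)) :
  fip A A = \sum_j sqnorm (fun i => A i j).
Proof.
rewrite fipE exchange_big; apply: eq_bigr => j _; apply: eq_bigr => i _.
by rewrite expr2.
Qed.

Lemma sqnorm_eq0 m (x : 'I_m -> R) : sqnorm x = 0 -> forall i, x i = 0.
Proof.
move=> x0 i; apply/eqP; rewrite -sqrf_eq0 eq_le sqr_ge0 andbT -x0.
exact: sqnorm_coord.
Qed.

(** Test the bilinear form on [y] and on its image [z = A y], both normalised. *)
Lemma spectral_le_sqnorm m n (A : 'M[R]_(m, n)) s (y : 'I_n -> R) :
  0 <= s -> spectral_le A s ->
  sqnorm (fun i => \sum_j A i j * y j) <= s ^+ 2 * sqnorm y.
Proof.
move=> s0 As; set z := fun i => _.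
have bilz : bil A z y = sqnorm z.
  rewrite /bil /sqnorm; apply: eq_bigr => i _; rewrite expr2 {2}/z mulr_sumr.
  by apply: eq_bigr => j _; rewrite mulrA.
have [z0|z0] := eqVneq (sqnorm z) 0.
  by rewrite z0 mulr_ge0 ?sqr_ge0 ?sqnorm_ge0.
have [y0|y0] := eqVneq (sqnorm y) 0.
  exfalso; move/eqP: z0; apply; rewrite /sqnorm big1// => i _.
  rewrite /z big1 ?expr0n// => j _; by rewrite (sqnorm_eq0 y0) mulr0.
have zp : 0 < sqnorm z by rewrite lt_def z0 sqnorm_ge0.
have yp : 0 < sqnorm y by rewrite lt_def y0 sqnorm_ge0.
have unit m' (x : 'I_m' -> R) : 0 < sqnorm x ->
    sqnorm (fun i => (Num.sqrt (sqnorm x))^-1 * x i) <= 1.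
  move=> x0; rewrite sqnormZ exprVn sqr_sqrtr ?sqnorm_ge0// mulVf//.
  by rewrite gt_eqF.
have := As _ _ (unit _ _ zp) (unit _ _ yp); rewrite bilZl bilZr bilz.
set a := Num.sqrt _; set b := Num.sqrt _.
have a0 : 0 < a by rewrite sqrtr_gt0.
have b0 : 0 < b by rewrite sqrtr_gt0.
have aa : a ^+ 2 = sqnorm z by rewrite sqr_sqrtr// ltW.
have bb : b ^+ 2 = sqnorm y by rewrite sqr_sqrtr// ltW.
rewrite -aa -bb (_ : a^-1 * _ = a / b); last by field; rewrite !gt_eqF.
rewrite ler_pdivrMr// => h.
by rewrite -exprMn lerXn2r ?nnegrE ?mulr_ge0 ?(ltW a0) ?(ltW b0).
Qed.

Lemma spectral_le_trmx m n (A : 'M[R]_(m, n)) s :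
  spectral_le A s -> spectral_le A^T s.
Proof.
move=> As x y x1 y1; have := As y x y1 x1; rewrite /bil exchange_big.
congr (_ <= _); apply: eq_bigr => i _; apply: eq_bigr => j _.
by rewrite mxE; ring.
Qed.

Lemma opnorm_le_of_spectral_le m n (A : 'M[R]_(m, n)) s :
  0 <= s -> spectral_le A s -> opnorm_le A s.
Proof.
move=> s0.
have H m' n' (B : 'M[R]_(m', n')) : spectral_le B s ->
    forall p (C : 'M[R]_(n', p)), frobenius (B *m C) <= s * frobenius C.
  move=> Bs p C; apply: frobenius_le => //.
  rewrite !fip_col_sqnorm mulr_sumr; apply: ler_sum => j _.
  have := spectral_le_sqnorm (fun i => C i j) s0 Bs.
  by congr (_ <= _); rewrite /sqnorm; apply: eq_bigr => i _; rewrite mxE.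
move=> As; apply: opnorm_le_left => //; apply: H => //; exact: spectral_le_trmx.
Qed.

End spectral_opb.

(** * Dilations *)

Section dilation_theory.
Context (R : realType).

Lemma fip_col_mx m1 m2 n (A C : 'M[R]_(m1, n)) (B D : 'M[R]_(m2, n)) :
  fip (col_mx A B) (col_mx C D) = fip A C + fip B D.
Proof. by rewrite /fip tr_col_mx mul_row_col linearD. Qed.

Lemma fip_row_mx m n1 n2 (A C : 'M[R]_(m, n1)) (B D : 'M[R]_(m, n2)) :
  fip (row_mx A B) (row_mx C D) = fip A C + fip B D.
Proof.
rewrite /fip mxtrace_mulC tr_row_mx mul_row_col linearD /=.
by rewrite !(mxtrace_mulC _ (_^T)).
Qed.

Lemma fip0l m n (A : 'M[R]_(m, n)) : fip 0 A = 0.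
Proof. by rewrite /fip trmx0 mul0mx linear0. Qed.

Lemma fip_block_diag m1 m2 n1 n2 (A : 'M[R]_(m1, n1)) (B : 'M[R]_(m2, n2)) :
  fip (block_mx A 0 0 B) (block_mx A 0 0 B) = fip A A + fip B B.
Proof.
rewrite -[block_mx A _ _ _]/(col_mx _ _) fip_col_mx !fip_row_mx.
by rewrite !fip0l addr0 add0r.
Qed.

Lemma fip_dilation m n (A : 'M[R]_(m, n)) :
  fip (dilation A) (dilation A) = 2 * fip A A.
Proof.
rewrite -[dilation A]/(col_mx _ _) fip_col_mx !fip_row_mx !fip0l addr0 add0r.
by rewrite -!sqr_frobenius frobenius_trmx; ring.
Qed.

Lemma dilationD m n (A B : 'M[R]_(m, n)) :
  dilation A + dilation B = dilation (A + B).
Proof. by rewrite /dilation add_block_mx !addr0 linearD. Qed.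

Lemma mul_dilation m n (A B : 'M[R]_(m, n)) :
  dilation A *m dilation B = block_mx (A *m B^T) 0 0 (A^T *m B).
Proof.
by rewrite /dilation mulmx_block !mul0mx !mulmx0 !addr0 !add0r.
Qed.

Lemma mul_block_dilation m n (P : 'M[R]_m) (Q : 'M[R]_n) (A : 'M[R]_(m, n)) :
  block_mx P 0 0 Q *m dilation A = block_mx 0 (P *m A) (Q *m A^T) 0.
Proof.
by rewrite /dilation mulmx_block !mul0mx !mulmx0 !addr0 !add0r.
Qed.

Lemma mul_dilation_block m n (P : 'M[R]_m) (Q : 'M[R]_n) (A : 'M[R]_(m, n)) :
  dilation A *m block_mx P 0 0 Q = block_mx 0 (A *m Q) (A^T *m P) 0.
Proof.
by rewrite /dilation mulmx_block !mul0mx !mulmx0 !addr0 !add0r.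
Qed.

(** The dilation exchanges the two blocks and multiplies them by [A] and its
    transpose. *)
Lemma opnorm_le_dilation m n (A : 'M[R]_(m, n)) c :
  opnorm_le A c -> opnorm_le (dilation A) c.
Proof.
move=> Ac; have [c0 Al _] := Ac; have [_ Atl _] := opnorm_le_trmx Ac.
have H p (B : 'M[R]_(m + n, p)) :
    frobenius (dilation A *m B) <= c * frobenius B.
  apply: frobenius_le => //; rewrite -(vsubmxK B) /dilation mul_block_col.
  rewrite !mul0mx add0r addr0 !fip_col_mx mulrDr addrC.
  rewrite -!sqr_frobenius -!exprMn.
  by apply: lerD; rewrite lerXn2r ?nnegrE ?mulr_ge0 ?frobenius_ge0.
apply: opnorm_le_left => // p B.
by rewrite /dilation tr_block_mx !trmx0 trmxK.
Qed.

Lemma orth_proj_block m n (P : 'M[R]_m) (Q : 'M[R]_n) :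
  orth_proj P -> orth_proj Q -> orth_proj (block_mx P 0 0 Q).
Proof.
move=> [Pt PP] [Qt QQ]; split; first by rewrite tr_block_mx !trmx0 Pt Qt.
by rewrite mulmx_block !mul0mx !mulmx0 !addr0 !add0r PP QQ.
Qed.

Definition block_proj d1 d2 r (U : 'M[R]_(d1, r)) (V : 'M[R]_(d2, r)) :
  'M[R]_(d1 + d2) := block_mx (U *m U^T) 0 0 (V *m V^T).

Lemma block_projP d1 d2 r (U : 'M[R]_(d1, r)) (V : 'M[R]_(d2, r)) :
  U^T *m U = 1%:M -> V^T *m V = 1%:M -> orth_proj (block_proj U V).
Proof. by move=> UU VV; apply: orth_proj_block; exact: orth_proj_isometry. Qed.

Lemma mxtrace_block_proj d1 d2 r (U : 'M[R]_(d1, r)) (V : 'M[R]_(d2, r)) :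
  U^T *m U = 1%:M -> V^T *m V = 1%:M -> \tr (block_proj U V) = 2 * r%:R.
Proof.
move=> UU VV; rewrite mxtrace_block (mxtrace_mulC U) (mxtrace_mulC V) UU VV.
by rewrite mxtrace1; ring.
Qed.

Lemma dist2E d1 d2 r (Uh U : 'M[R]_(d1, r)) (Vh V : 'M[R]_(d2, r)) :
  dist2 Uh Vh U V = frobenius (block_proj Uh Vh - block_proj U V) ^+ 2.
Proof.
rewrite /dist2 !sqr_frobenius /block_proj opp_block_mx add_block_mx !subr0.
by rewrite fip_block_diag.
Qed.

(** Transpose of the Moore-Penrose inverse of [U *m diag_mx s *m V^T], which is
    the off-diagonal block of the pseudo-inverse of the dilation. *)
Definition svd_inv d1 d2 r (U : 'M[R]_(d1, r)) (s : 'rV[R]_r) (V : 'M[R]_(d2, r)) :=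
  U *m diag_mx (\row_i (s 0 i)^-1) *m V^T.

Lemma mul_diag_inv r (s : 'rV[R]_r) : (forall i, s 0 i != 0) ->
  diag_mx s *m diag_mx (\row_i (s 0 i)^-1) = 1%:M.
Proof.
move=> s0; rewrite mulmx_diag -diag_const_mx; congr diag_mx.
by apply/rowP => i; rewrite !mxE divff.
Qed.

Lemma invmx_diag r (s : 'rV[R]_r) : (forall i, s 0 i != 0) ->
  invmx (diag_mx s) = diag_mx (\row_i (s 0 i)^-1).
Proof.
move=> s0; have sV := mul_diag_inv s0; have [su _] := mulmx1_unit sV.
by rewrite -[LHS]mulmx1 -sV mulmxA mulVmx// mul1mx.
Qed.

Lemma frakP_invE d1 d2 r (U : 'M[R]_(d1, r)) (s : 'rV[R]_r) (V : 'M[R]_(d2, r)) :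
  (forall i, s 0 i != 0) -> frakP_inv U s V = dilation (svd_inv U s V).
Proof.
move=> s0; rewrite /frakP_inv /dilation /svd_inv invmx_diag//.
by rewrite !trmx_mul tr_diag_mx trmxK mulmxA.
Qed.

Section svd.
Context (d1 d2 r : nat) (U : 'M[R]_(d1, r)) (s : 'rV[R]_r) (V : 'M[R]_(d2, r)).
Hypothesis UU : U^T *m U = 1%:M.
Hypothesis VV : V^T *m V = 1%:M.
Variable c : R.
Hypothesis c0 : 0 < c.
Hypothesis sc : forall i, c <= s 0 i.
Local Notation S := (svd_inv U s V).

Let s0 i : 0 < s 0 i. Proof. exact: lt_le_trans (sc i). Qed.

Lemma opnorm_le_svd_inv : opnorm_le S c^-1.
Proof.
rewrite /svd_inv -[c^-1]mul1r -[_ * _]mulr1; apply: opnorm_leM; last first.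
  exact/opnorm_le_trmx/opnorm_le_isometry.
apply: opnorm_leM; first exact: opnorm_le_isometry.
apply: opnorm_le_diag => [|i]; first by rewrite invr_ge0 ltW.
by rewrite mxE ger0_norm ?invr_ge0 ?(ltW (s0 i))// lef_pV2 ?posrE.
Qed.

Lemma fip_svd_inv : fip S S = \sum_i (s 0 i)^-1 ^+ 2.
Proof.
rewrite /svd_inv -mulmxA fip_isometry// -!sqr_frobenius -frobenius_trmx trmx_mul.
rewrite trmxK sqr_frobenius fip_isometry// tr_diag_mx fipE.
apply: eq_bigr => i _; rewrite (bigD1 i)//= big1 => [|j ji].
  by rewrite !mxE eqxx mulr1n addr0 expr2.
by rewrite !mxE eq_sym (negPf ji) mulr0n mul0r.
Qed.

Lemma frobenius_dilation_svd_inv :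
  frobenius (dilation S) <= c^-1 * Num.sqrt (2 * r%:R).
Proof.
rewrite -(@ler_pXn2r _ 2) ?nnegrE ?frobenius_ge0 ?mulr_ge0 ?sqrtr_ge0//; last first.
  by rewrite invr_ge0 ltW.
rewrite sqr_frobenius fip_dilation fip_svd_inv exprMn sqr_sqrtr ?mulr_ge0//.
rewrite mulrCA ler_wpM2l//.
apply: (@le_trans _ _ (\sum_(i < r) c^-1 ^+ 2)).
  apply: ler_sum => i _; rewrite lerXn2r ?nnegrE ?invr_ge0 ?(ltW (s0 i)) ?(ltW c0)//.
  by rewrite lef_pV2 ?posrE.
by rewrite sumr_const card_ord mulr_natr.
Qed.

Section block.
Variable A : 'M[R]_(d1, d2).
Hypothesis AV : A *m V = U *m diag_mx s.
Hypothesis AU : A^T *m U = V *m diag_mx s.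

Lemma dilation_svd_inv : dilation A *m dilation S = block_proj U V.
Proof.
have sV : diag_mx s *m diag_mx (\row_i (s 0 i)^-1) = 1%:M.
  by apply: mul_diag_inv => i; rewrite gt_eqF.
rewrite mul_dilation /svd_inv !trmx_mul trmxK tr_diag_mx; congr block_mx.
  by rewrite !mulmxA AV -(mulmxA U) sV mulmx1.
by rewrite !mulmxA AU -(mulmxA V) sV mulmx1.
Qed.

Lemma block_proj_svd_inv : block_proj U V *m dilation S = dilation S.
Proof.
rewrite /block_proj mul_block_dilation /dilation /svd_inv; congr block_mx.
  by rewrite !mulmxA -(mulmxA U) UU mulmx1.
by rewrite !trmx_mul !trmxK !mulmxA -(mulmxA V) VV mulmx1.
Qed.

Lemma mulmx_projl : U *m U^T *m A = U *m diag_mx s *m V^T.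
Proof.
by rewrite -mulmxA -[U^T *m A]trmxK trmx_mul trmxK AU trmx_mul tr_diag_mx mulmxA.
Qed.

Lemma mulmx_projr : V *m V^T *m A^T = V *m diag_mx s *m U^T.
Proof.
by rewrite -mulmxA -trmx_mul AV trmx_mul tr_diag_mx mulmxA.
Qed.

Lemma block_proj_comm : block_proj U V *m dilation A = dilation A *m block_proj U V.
Proof.
rewrite /block_proj mul_block_dilation mul_dilation_block !mulmxA AV AU.
by rewrite mulmx_projl mulmx_projr.
Qed.

Lemma block_projC_dilation :
  (1%:M - block_proj U V) *m dilation A = dilation (A - U *m diag_mx s *m V^T).
Proof.
rewrite mulmxBl mul1mx /block_proj mul_block_dilation mulmx_projl mulmx_projr.
rewrite /dilation opp_block_mx add_block_mx !subr0; congr block_mx.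
by rewrite linearB /= !trmx_mul trmxK tr_diag_mx mulmxA.
Qed.

End block.
End svd.
End dilation_theory.

(** * Weyl inequalities and leading singular vectors *)

Section weyl.
Context (R : realType).

Lemma ex_kernel_vector m n (B : 'M[R]_(m, n)) : (m < n)%N ->
  exists2 c : 'cV_n, c != 0 & B *m c = 0.
Proof.
move=> mn; have : kermx B^T != 0.
  rewrite -mxrank_eq0 mxrank_ker -lt0n subn_gt0.
  exact: leq_ltn_trans (rank_leq_col _) mn.
move=> /rowV0Pn[v /sub_kermxP vB v0]; exists v^T.
  by apply: contra_neq v0 => /(congr1 trmx); rewrite trmxK trmx0.
by apply: trmx_inj; rewrite trmx_mul trmxK vB trmx0.
Qed.

Lemma frobenius_gt0 m n (A : 'M[R]_(m, n)) : A != 0 -> 0 < frobenius A.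
Proof.
move=> A0; rewrite lt_def frobenius_ge0 andbT; apply: contra_neq A0 => fA.
apply/matrixP => i j; rewrite mxE.
have : fip A A = 0 by rewrite -sqr_frobenius fA expr0n.
rewrite fip_col_sqnorm => /eqP; rewrite psumr_eq0 => [|k _]; last exact: sqnorm_ge0.
by move=> /allP/(_ j (mem_index_enum _))/implyP/(_ isT)/eqP/sqnorm_eq0; apply.
Qed.

Lemma frobenius_isometry m n p (U : 'M[R]_(m, n)) (B : 'M[R]_(n, p)) :
  U^T *m U = 1%:M -> frobenius (U *m B) = frobenius B.
Proof. by move=> UU; apply: frobenius_eq; exact: fip_isometry. Qed.

Lemma fip_cV n (y : 'cV[R]_n) : fip y y = \sum_i y i 0 ^+ 2.
Proof. by rewrite fipE; apply: eq_bigr => i _; rewrite big_ord1 expr2. Qed.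

Lemma frobenius_diag_le n (s : 'rV[R]_n) (y : 'cV[R]_n) c : 0 <= c ->
  (forall i, 0 <= s 0 i) -> (forall i, y i 0 != 0 -> s 0 i <= c) ->
  frobenius (diag_mx s *m y) <= c * frobenius y.
Proof.
move=> c0 s0 sc; apply: frobenius_le => //; rewrite !fip_cV mulr_sumr.
apply: ler_sum => i _; rewrite mul_diag_mx mxE exprMn.
have [->|y0] := eqVneq (y i 0) 0; first by rewrite expr0n !mulr0.
by rewrite ler_wpM2r ?sqr_ge0// lerXn2r ?nnegrE// sc.
Qed.

Lemma frobenius_diag_ge n (s : 'rV[R]_n) (y : 'cV[R]_n) c : 0 <= c ->
  (forall i, 0 <= s 0 i) -> (forall i, y i 0 != 0 -> c <= s 0 i) ->
  c * frobenius y <= frobenius (diag_mx s *m y).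
Proof.
move=> c0 s0 sc; rewrite -(@ler_pXn2r _ 2) ?nnegrE ?mulr_ge0 ?frobenius_ge0//.
rewrite exprMn !sqr_frobenius !fip_cV mulr_sumr.
apply: ler_sum => i _; rewrite mul_diag_mx mxE exprMn.
have [->|y0] := eqVneq (y i 0) 0; first by rewrite expr0n !mulr0.
by rewrite ler_wpM2r ?sqr_ge0// lerXn2r ?nnegrE// sc.
Qed.

Context (d1 d2 r k : nat) (M Z : 'M[R]_(d1, d2)).
Context (U : 'M[R]_(d1, r)) (lam : 'rV[R]_r) (V : 'M[R]_(d2, r)).
Context (W : 'M[R]_(d1, k)) (t : 'rV[R]_k) (Y : 'M[R]_(d2, k)).
Hypothesis svdM : thin_svd M U lam V.
Hypothesis svdMh : thin_svd (M + Z) W t Y.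
Variable s : R.
Hypothesis Zs : opnorm_le Z s.

(** Weyl's inequality, by counting dimensions: the [r]-dimensional range of [V]
    meets the orthogonal complement of the first [i] singular vectors of
    [M + Z]. On a common vector, [M + Z] expands by at most [t 0 j], whereas
    [M] expands by at least [c] and [Z] by at most [s]. *)
Lemma weyl_lower (c : R) (i : 'I_r) (j : 'I_k) : i = j :> nat ->
  0 <= c -> (forall a, c <= lam 0 a) -> c - s <= t 0 j.
Proof.
move=> ij c0 clam.
have [ME UU VV _ lam0] := svdM; have [MhE WW YY tdec t0] := svdMh.
have [x x0 Bx] := @ex_kernel_vector _ _
  ((pid_mx i : 'M[R]_(i, k)) *m (Y^T *m V)) (ltn_ord i).
have xp := frobenius_gt0 x0.
set y := Y^T *m (V *m x).
have y0 (a : 'I_k) : (a < i)%N -> y a 0 = 0.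
  move=> ai; have := congr1 (fun u : 'cV_i => u (Ordinal ai) 0) Bx.
  rewrite -mulmxA -mulmxA -/y mxE (bigD1 a)//= big1 => [|b ba]; last first.
    by rewrite mxE /= eq_sym (negPf (_ : val b != val a))// mul0r.
  by rewrite [X in X * _]mxE /= eqxx ai mul1r addr0 => ->; rewrite mxE.
have up : frobenius ((M + Z) *m (V *m x)) <= t 0 j * frobenius x.
  rewrite MhE -!mulmxA frobenius_isometry//.
  apply: (@le_trans _ _ (t 0 j * frobenius y)).
    apply: frobenius_diag_le => // a ya; apply: tdec; rewrite -ij leqNgt.
    by apply: contraNN ya => /y0 ->.
  rewrite ler_wpM2l// /y -[frobenius x](frobenius_isometry _ VV).
  have [_ + _] := opnorm_le_trmx (opnorm_le_isometry YY).
  by move=> /(_ _ (V *m x)); rewrite mul1r.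
have lo : c * frobenius x <= frobenius (M *m (V *m x)).
  rewrite ME -!mulmxA (mulmxA V^T) VV mul1mx frobenius_isometry//.
  by apply: frobenius_diag_ge.
have Zx : frobenius (Z *m (V *m x)) <= s * frobenius x.
  by rewrite -[frobenius x](frobenius_isometry _ VV); have [_ + _] := Zs; apply.
have tri : frobenius (M *m (V *m x)) <=
    frobenius ((M + Z) *m (V *m x)) + frobenius (Z *m (V *m x)).
  rewrite -[X in _ <= _ + X]frobeniusN; apply: le_trans (frobeniusD _ _).
  by rewrite mulmxDl addrK.
rewrite -(ler_pM2r xp); lra.
Qed.

(** The dual count: the span of [r + 1] or more leading singular vectors of
    [M + Z] meets the kernel of [M], and there [M + Z] acts as [Z]. *)
Lemma weyl_upper (j : 'I_k) : (r <= j)%N -> t 0 j <= s.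
Proof.
move=> rj.
have [ME UU VV _ lam0] := svdM; have [MhE WW YY tdec t0] := svdMh.
pose K : 'M[R]_(k, j.+1) := pid_mx j.+1.
have KK : K^T *m K = 1%:M.
  rewrite tr_pid_mx mul_pid_mx minnn.
  have -> : minn k j.+1 = j.+1 by apply/minn_idPr.
  exact: pid_mx_1.
have [x x0 Bx] := @ex_kernel_vector _ _ (V^T *m (Y *m K)) rj.
have xp := frobenius_gt0 x0.
have Kx (a : 'I_k) : (K *m x) a 0 != 0 -> (a <= j)%N.
  rewrite leqNgt; apply: contraNN => ja; rewrite mxE big1// => b _.
  by rewrite mxE ltnS leqNgt ja andbF mul0r.
have lo : t 0 j * frobenius x <= frobenius ((M + Z) *m (Y *m K *m x)).
  rewrite MhE -!mulmxA (mulmxA Y^T) YY mul1mx frobenius_isometry//.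
  rewrite -[frobenius x](frobenius_isometry _ KK).
  by apply: frobenius_diag_ge => // a /Kx; exact: tdec.
have up : frobenius ((M + Z) *m (Y *m K *m x)) <= s * frobenius x.
  have VYx : V^T *m (Y *m (K *m x)) = 0 by rewrite -Bx !mulmxA.
  rewrite mulmxDl ME -!mulmxA VYx !mulmx0 add0r.
  rewrite -[frobenius x](frobenius_isometry _ KK).
  rewrite -[frobenius (K *m x)](frobenius_isometry _ YY).
  by have [_ + _] := Zs; apply.
by rewrite -(ler_pM2r xp); exact: le_trans up.
Qed.

(** The leading [r] columns of an SVD, extracted by the partial identity [J]. All
    that the perturbation argument needs to know about them is that they are
    invariant under [M + Z], that their singular values stay away from zero,
    and that the rest of the matrix has operator norm at most [s]. *)
Lemma top_part (rk : (r <= k)%N) (Uh : 'M[R]_(d1, r)) (Vh : 'M[R]_(d2, r)) :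
  (forall (i : 'I_r) (j : 'I_k), i = j :> nat ->
     col i Uh = col j W /\ col i Vh = col j Y) ->
  exists sg : 'rV[R]_r,
  [/\ Uh^T *m Uh = 1%:M /\ Vh^T *m Vh = 1%:M,
      (M + Z) *m Vh = Uh *m diag_mx sg, (M + Z)^T *m Uh = Vh *m diag_mx sg,
      forall c, 0 <= c -> (forall a, c <= lam 0 a) -> forall i, c - s <= sg 0 i &
      opnorm_le (M + Z - Uh *m diag_mx sg *m Vh^T) s].
Proof.
move=> UVh.
have [MhE WW YY tdec t0] := svdMh; have s0 : 0 <= s by case: Zs.
pose J : 'M[R]_(k, r) := pid_mx r.
pose sg : 'rV[R]_r := \row_i t 0 (widen_ord rk i).
have JE m (B : 'M[R]_(m, k)) (C : 'M[R]_(m, r)) :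
    (forall i : 'I_r, col i C = col (widen_ord rk i) B) -> C = B *m J.
  move=> CB; apply/matrixP => a i; rewrite mxE (bigD1 (widen_ord rk i))//=.
  rewrite big1 => [|b bi]; last first.
    by rewrite mxE (negPf (_ : val b != val i)) ?mulr0.
  rewrite mxE /= eqxx ltn_ord mulr1 addr0.
  by have /(congr1 (fun u : 'cV_m => u a 0)) := CB i; rewrite !mxE.
have UhE : Uh = W *m J by apply: JE => i; have [] := UVh i (widen_ord rk i) erefl.
have VhE : Vh = Y *m J by apply: JE => i; have [] := UVh i (widen_ord rk i) erefl.
have JJ : J^T *m J = 1%:M.
  by rewrite tr_pid_mx mul_pid_mx minnn (minn_idPr rk) pid_mx_1.
have tJ : diag_mx t *m J = J *m diag_mx sg.
  apply/matrixP => a i; rewrite mul_diag_mx mul_mx_diag !mxE.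
  have [ai|ai] := eqVneq (a : nat) i; last by rewrite !(mulr0, mul0r).
  rewrite mulrC; congr (_ * _); rewrite [RHS]/=; congr (t 0 _).
  exact: val_inj.
exists sg; split; first split.
- by rewrite UhE trmx_mul -mulmxA (mulmxA W^T) WW mul1mx.
- by rewrite VhE trmx_mul -mulmxA (mulmxA Y^T) YY mul1mx.
- by rewrite MhE VhE UhE -!mulmxA (mulmxA Y^T) YY mul1mx tJ.
- rewrite MhE VhE UhE !trmx_mul trmxK tr_diag_mx -!mulmxA (mulmxA W^T) WW mul1mx.
  by rewrite tJ.
- by move=> c c0 clam i; rewrite mxE; apply: weyl_lower clam.
have -> : M + Z - Uh *m diag_mx sg *m Vh^T =
    W *m diag_mx (\row_j (if (j < r)%N then 0 else t 0 j)) *m Y^T.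
  rewrite MhE UhE VhE trmx_mul -(mulmxA W J) -tJ !mulmxA -mulmxBl.
  congr (_ *m _); rewrite -!mulmxA -mulmxBr; congr (_ *m _).
  rewrite tr_pid_mx mul_pid_mx !minnn.
  rewrite mul_diag_mx; apply/matrixP => a b; rewrite !mxE.
  have [->|ab] := eqVneq a b; last first.
    by rewrite [(_ : nat) == _](negPf ab) !mulr0n mulr0 subrr.
  by rewrite !eqxx /= !mulr1n; case: ltnP => _; rewrite ?mulr1 ?mulr0 ?subrr ?subr0.
rewrite -[s]mul1r -[_ * _]mulr1; apply: opnorm_leM;
  last exact/opnorm_le_trmx/opnorm_le_isometry.
apply: opnorm_leM; first exact: opnorm_le_isometry.
apply: opnorm_le_diag => // j; rewrite mxE; case: ltnP => [_|rj].
  by rewrite normr0.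
by rewrite ger0_norm//; exact: weyl_upper.
Qed.

End weyl.

(** * Deterministic expansion of the distance *)

Section expansion.
Context (R : realType) (d1 d2 r : nat) (hr : (0 < r)%N).
Context (M Z : 'M[R]_(d1, d2)) (U : 'M[R]_(d1, r)) (lam : 'rV[R]_r)
  (V : 'M[R]_(d2, r)) (Uh : 'M[R]_(d1, r)) (Vh : 'M[R]_(d2, r)) (s : R).

(** The perturbation bounds for the dilations of [M] and [Z]. The range projector
    of the dilation of [M] is [block_proj U V], of rank [2 * r], and its
    pseudo-inverse is [frakP_inv U lam V]. The factor [2 ^+ 9 * r] is 256 times
    that rank. *)
Lemma dist2_expansion :
  low_rank_model M U lam V -> 0 <= s -> spectral_le Z s ->
  top_singular_vectors (M + Z) Uh Vh ->
  let F1 := first_order (dilation Z) (block_proj U V) (frakP_inv U lam V) in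
  let F2 := second_order (dilation Z) (block_proj U V) (frakP_inv U lam V) in
  `|dist2 Uh Vh U V - 2 * frobenius F1 ^+ 2 - 4 * fip F1 F2|
    <= 2 ^+ 9 * r%:R * (s / lam 0 (last_idx hr)) ^+ 4.
Proof.
move=> [svdM lam0] s0 Zs [rk [W [t [Y [svdMh UVh]]]]] /=.
have [ME UU VV ldec _] := svdM.
have Zo := opnorm_le_of_spectral_le s0 Zs.
set c := lam 0 (last_idx hr).
have c0 : 0 < c by exact: lam0.
have cl a : c <= lam 0 a.
  by apply: ldec; rewrite /= -ltnS prednK.
have [sg [[UUh VVh] MVh MUh weyl res]] := top_part svdM svdMh Zo rk UVh.
rewrite dist2E frakP_invE; last by move=> i; rewrite gt_eqF.
pose rho := Num.sqrt (2 * r%:R : R).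
have rho2 : rho ^+ 2 = 2 * r%:R by rewrite sqr_sqrtr// mulr_ge0.
have -> : 2 ^+ 9 * r%:R * (s / c) ^+ 4 = 256 * rho ^+ 2 * (s * c^-1) ^+ 4.
  by rewrite rho2; ring.
have MV : M *m V = U *m diag_mx lam by rewrite ME -!mulmxA VV mulmx1.
have MU : M^T *m U = V *m diag_mx lam.
  by rewrite ME !trmx_mul trmxK tr_diag_mx -!mulmxA UU mulmx1.
have Xo := opnorm_le_dilation Zo.
have To := opnorm_le_dilation (opnorm_le_svd_inv UU VV c0 cl).
have Tf := frobenius_dilation_svd_inv UU VV c0 cl.
have PP := block_projP UU VV; have PPh := block_projP UUh VVh.
have trP : \tr (block_proj U V) = rho ^+ 2 by rewrite rho2 mxtrace_block_proj.
have trPh : \tr (block_proj Uh Vh) = rho ^+ 2 by rewrite rho2 mxtrace_block_proj.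
have PA : block_proj U V *m dilation M = dilation M.
  rewrite /block_proj mul_block_dilation /dilation.
  by rewrite (mulmx_projl MU) (mulmx_projr MV) ME !trmx_mul trmxK tr_diag_mx mulmxA.
have AT : dilation M *m dilation (svd_inv U lam V) = block_proj U V.
  exact: (dilation_svd_inv (c := c)).
have PT : block_proj U V *m dilation (svd_inv U lam V) =
    dilation (svd_inv U lam V) by exact: block_proj_svd_inv.
have rho0 : 0 <= rho by exact: sqrtr_ge0.
have [small|large] := leP (s * c^-1) (1 / 2); last first.
  by apply: projector_expansion_large; rewrite ?(ltW large).
have s2 : s <= c / 2 by move: small; rewrite ler_pdivrMr//; lra.
have c2 : 0 < c / 2 by rewrite divr_gt0.
have cs i : c / 2 <= sg 0 i by have := weyl c (ltW c0) cl i; lra.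
have Tho := opnorm_le_dilation (opnorm_le_svd_inv UUh VVh c2 cs).
have Thf := frobenius_dilation_svd_inv UUh VVh c2 cs.
rewrite invf_div in Tho; rewrite invf_div in Thf.
apply: (@projector_expansion_small _ _ (dilation M) _ _ _ (block_proj Uh Vh)
  (dilation (svd_inv Uh sg Vh))) => //.
- by rewrite dilationD; exact: block_proj_comm MVh MUh.
- by rewrite dilationD; exact: (dilation_svd_inv (c := c / 2)).
- by rewrite dilationD (block_projC_dilation MVh MUh); exact: opnorm_le_dilation.
Qed.

End expansion.

(** * Gaussian moment generating functions and independence *)

(** If [nu] is the image under [X] of the measure with density [g] with respect to
    [mu], integrals against [nu] are the expected ones. The identity is checked
    on simple functions and extended by monotone convergence. It serves twice:
    for the Gaussian density, and for a law reweighted by an independent factor. *)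
Section density.
Local Open Scope ereal_scope.
Context d d' (T : measurableType d) (T' : measurableType d') (R : realType).
Variables (mu : {measure set T -> \bar R}) (nu : {measure set T' -> \bar R}).
Variables (X : T -> T') (g : T -> R).
Hypothesis mX : measurable_fun [set: T] X.
Hypothesis mg : measurable_fun [set: T] g.
Hypothesis g0 : forall x, (0 <= g x)%R.
Hypothesis nuE : forall B, measurable B ->
  nu B = \int[mu]_x (\1_B (X x) * g x)%:E.

Import HBNNSimple.

Let integral_simple (h : {nnsfun T' >-> R}) :
  \int[nu]_y (h y)%:E = \int[mu]_x (h (X x) * g x)%:E.
Proof.
have mh r : measurable (h @^-1` [set r]) by [].
have mih r : measurable_fun setT (fun x => \1_(h @^-1` [set r]) (X x) : R).
  by apply: measurableT_comp => //; exact: measurable_indic.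
transitivity (\int[nu]_y (\sum_(r \in range h)
    (r * \1_(h @^-1` [set r]) y)%:E)).
  by apply: eq_integral => y _; rewrite fimfunE -fsumEFin.
rewrite ge0_integral_fsum//; last 2 first.
  - by move=> r; apply/measurable_EFinP/measurable_funM => //.
  - by move=> r y _; exact: nnfun_muleindic_ge0.
transitivity (\int[mu]_x (\sum_(r \in range h)
    (r * \1_(h @^-1` [set r]) (X x) * g x)%:E)); last first.
  apply: eq_integral => x _; rewrite fimfunE fsumEFin//.
  congr EFin; rewrite [in LHS]fsbig_finite//=.
  by rewrite [in RHS]fsbig_finite//= mulr_suml.
rewrite ge0_integral_fsum//; last 2 first.
  - move=> r; apply/measurable_EFinP; apply: measurable_funM => //.
    exact: measurable_funM.
  - move=> r x _; rewrite EFinM mule_ge0 ?lee_fin//.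
    exact: nnfun_muleindic_ge0.
apply: eq_fsbigr => r _.
have [r0|r0] := ltP r 0%R.
  rewrite !integral0_eq// => x _; rewrite preimage_nnfun0// indic0 ?mulr0//.
  by rewrite mul0r.
under eq_integral do rewrite EFinM.
rewrite ge0_integralZl_EFin//; last exact/measurable_EFinP.
under [RHS]eq_integral do rewrite -mulrA EFinM.
rewrite ge0_integralZl_EFin//; last 2 first.
  - by move=> x _; rewrite lee_fin mulr_ge0.
  - by apply/measurable_EFinP; exact: measurable_funM.
by rewrite integral_indic// setIT nuE.
Qed.

Lemma ge0_integral_density (f : T' -> R) : measurable_fun [set: T'] f ->
  (forall y, (0 <= f y)%R) ->
  \int[nu]_y (f y)%:E = \int[mu]_x (f (X x) * g x)%:E.
Proof.
move=> mf f0.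
have mf' : measurable_fun [set: T'] (EFin \o f) by exact/measurable_EFinP.
pose h := nnsfun_approx measurableT mf'.
have hf y : (EFin \o h^~ y) n @[n --> \oo] --> (f y)%:E.
  by apply: (@cvg_nnsfun_approx _ _ _ _ measurableT (EFin \o f) mf') => // z _;
    rewrite lee_fin.
have ndh m n y : (m <= n)%N -> (h m y <= h n y)%R.
  by move=> mn; exact/lefP/nd_nnsfun_approx.
transitivity (limn (fun n => \int[nu]_y (h n y)%:E)).
  rewrite -monotone_convergence//.
  - by apply: eq_integral => y _; apply/esym/cvg_lim => //; exact: hf.
  - by move=> n; apply/measurable_EFinP.
  - by move=> n y _; rewrite lee_fin.
  - by move=> y _ m n mn; rewrite lee_fin ndh.
under eq_fun do rewrite integral_simple.
rewrite -monotone_convergence//.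
- apply: eq_integral => x _; apply/cvg_lim => //.
  rewrite EFinM (_ : (fun n => _) = (fun n => (h n (X x))%:E * (g x)%:E)) //.
  exact: (cvgeZr _ (hf (X x))).
- move=> n; apply/measurable_EFinP; apply: measurable_funM => //.
  exact: measurableT_comp.
- by move=> n x _; rewrite lee_fin mulr_ge0.
- by move=> x _ m n mn; rewrite lee_fin ler_wpM2r ?ndh.
Qed.

End density.

Section normal.
Local Open Scope ereal_scope.
Context (R : realType).

(** Completing the square turns [expR (a * x)] times the standard density into
    [expR (a ^+ 2 / 2)] times the density centred at [a]. *)
Lemma normal_mgf (nu : {measure set R -> \bar R}) (a : R) :
  (forall B, measurable B -> nu B = normal_prob 0 1 B) ->
  \int[nu]_x (expR (a * x))%:E = (expR (a ^+ 2 / 2))%:E.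
Proof.
move=> nuE.
have mexp : measurable_fun [set: R] (fun x : R => expR (a * x)).
  by apply: measurableT_comp => //; exact: measurable_funM.
rewrite (@ge0_integral_density _ _ (measurableTypeR R) R R lebesgue_measure nu idfun
  (normal_pdf 0 1))//.
- transitivity (\int[lebesgue_measure]_x
      ((expR (a ^+ 2 / 2))%:E * (normal_pdf a 1 x)%:E)).
    apply: eq_integral => x _; rewrite -EFinM; congr EFin.
    rewrite !normal_pdfE ?oner_eq0// mulrCA [RHS]mulrCA; congr (_ * _)%R.
    rewrite /normal_fun /= -!expRD; congr expR.
    by rewrite expr1n; field.
  rewrite (@ge0_integralZl_EFin _ _ _ lebesgue_measure setT measurableT
    (EFin \o normal_pdf a 1)) ?expR_ge0//.
  + by rewrite integral_normal_pdf mule1.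
  + by move=> x _; rewrite lee_fin normal_pdf_ge0.
  + by apply/measurable_EFinP; exact: measurable_normal_pdf.
- exact: measurable_id.
- exact: measurable_normal_pdf.
- by move=> x; exact: normal_pdf_ge0.
- move=> B mB; rewrite nuE//.
  transitivity (\int[lebesgue_measure]_(x in B) (normal_pdf 0 1 x)%:E) => //.
  rewrite [LHS]integral_mkcond.
  apply: eq_integral => x _; rewrite /patch indicE; case: ifPn => //= xB.
  + by rewrite mul1r.
  + by rewrite mul0r.
Qed.
End normal.

Section indep.
Local Open Scope ereal_scope.
Context d (Omega : measurableType d) (R : realType) (P : probability Omega R).
Context (I : finType) (X : I -> {RV P >-> R}).
Hypothesis indX : mutually_independent X.

Let integral_prod_indic (B : I -> set R) : (forall i, measurable (B i)) ->
  \int[P]_w (\prod_i (\1_(B i) (X i w) : R))%:E = \prod_i P (X i @^-1` B i).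
Proof.
move=> mB.
have mXB i : measurable (X i @^-1` B i).
  by rewrite -[X in measurable X]setTI; exact: measurable_funP.
transitivity (P (\bigcap_(i in [set i | i \in [set: I]%SET]) (X i @^-1` B i))).
  set A := \bigcap_(i in _) _.
  rewrite -(setIT A) -(@integral_indic _ _ _ P setT measurableT A); last first.
    apply: fin_bigcap_measurable; [exact: finite_finset|move=> i _; exact: mXB].
  apply: eq_integral => w _; congr EFin.
  rewrite indicE; have [/set_mem wB|/negP wB] := boolP (w \in A).
    rewrite big1// => i _; rewrite indicE mem_set//.
    by apply: wB; rewrite /= inE.
  have [/forallP allB|] := boolP [forall i, w \in X i @^-1` B i].
    by exfalso; apply: wB; apply/mem_set => i _; exact/set_mem/allB.
  rewrite negb_forall => /existsP[i iB]; rewrite (bigD1 i)//= indicE.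
  rewrite memNset ?mul0r//; last by move=> wi; move/negP: iB; apply; exact/mem_set.
by rewrite indX//; apply: eq_bigl => i; rewrite inE.
Qed.

(** Independence is given for events, that is, for indicator functions. The
    indicators are replaced by arbitrary nonnegative functions one index at a
    time: reweighting by the other factors multiplies the law of [X k] by a
    constant, which is the formula with the indicator of an arbitrary set at
    [k], and [ge0_integral_density] passes from sets to functions. *)
Lemma integral_prod_indep (f : I -> R -> R) (e : I -> R) :
  (forall i, measurable_fun setT (f i)) -> (forall i x, (0 <= f i x)%R) ->
  (forall i, \int[P]_w (f i (X i w))%:E = (e i)%:E) ->
  \int[P]_w (\prod_i f i (X i w))%:E = (\prod_i e i)%:E.
Proof.
have H (s : seq I) : forall (f : I -> R -> R) (e : I -> R),
  (forall i, measurable_fun setT (f i)) -> (forall i x, (0 <= f i x)%R) ->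
  (forall i, \int[P]_w (f i (X i w))%:E = (e i)%:E) ->
  (forall i, i \notin s -> exists2 B, measurable B & f i = \1_B) ->
  \int[P]_w (\prod_i f i (X i w))%:E = (\prod_i e i)%:E; last first.
  move=> mf f0 fe; apply: (H (enum I)) => // i.
  by rewrite mem_enum.
elim: s => [|k s IHs] {}f {}e mf f0 fe indf.
  have {}indf i : exists B, measurable B /\ f i = \1_B.
    by have [//|B mB fB] := indf i; exists B.
  have [B /all_and2[mB fB]] := choice indf.
  under eq_integral do under eq_bigr do rewrite fB.
  rewrite integral_prod_indic// -prodEFin; apply: eq_bigr => i _.
  rewrite -fe fB -[X in P X]setIT -integral_indic//.
  by rewrite -[X in measurable X]setTI; exact: measurable_funP.
have e0 i : (0 <= e i)%R.
  by rewrite -lee_fin -fe integral_ge0// => w _; rewrite lee_fin.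
have c0 : (0 <= \prod_(i | i != k) e i)%R by exact: prodr_ge0.
pose c := NngNum c0.
pose g w := (\prod_(i | i != k) f i (X i w))%R.
have mg : measurable_fun setT g.
  rewrite /g; under eq_fun do rewrite -big_filter.
  apply: measurable_prod => i _; exact: measurableT_comp.
have g0 w : (0 <= g w)%R by exact: prodr_ge0.
transitivity (\int[P]_w (f k (X k w) * g w)%:E).
  by apply: eq_integral => w _; rewrite (bigD1 k).
rewrite -(@ge0_integral_density _ _ _ _ _ P
  (mscale c (distribution P (X k))) (X k) g)//; last first.
  move=> B mB.
  pose f' j := if j == k then \1_B else f j.
  pose e' j := if j == k then fine (P (X k @^-1` B)) else e j.
  have mXB : measurable (X k @^-1` B).
    by rewrite -[X in measurable X]setTI; exact: measurable_funP.
  transitivity (\prod_i e' i)%:E.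
    rewrite (bigD1 k)//= /e' eqxx /mscale /= muleC EFinM fineK; last first.
      by rewrite fin_num_measure.
    congr (_ * _); congr EFin; apply: eq_bigr => i /negPf ->; by [].
  rewrite -(IHs f').
  - apply: eq_integral => w _; rewrite (bigD1 k)//= /f' eqxx; congr EFin.
    by congr (_ * _)%R; apply: eq_bigr => i /negPf ->.
  - by move=> i; rewrite /f'; case: ifP => // _; exact: measurable_indic.
  - by move=> i x; rewrite /f'; case: ifP.
  - move=> i; rewrite /f' /e'; case: eqVneq => [->|] //.
    rewrite fineK ?fin_num_measure// -[in RHS](setIT (X k @^-1` B)).
    by rewrite -integral_indic.
  - move=> i is_; rewrite /f'; case: eqVneq => [_|ik]; first by exists B.
    by apply: indf; rewrite inE negb_or ik.
rewrite ge0_integral_mscale//; last 2 first.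
  - exact/measurable_EFinP.
  - by move=> y _; rewrite lee_fin.
rewrite ge0_integral_distribution//; last 2 first.
  - exact/measurable_EFinP.
  - by move=> y; rewrite lee_fin.
by rewrite [X in _ * X](fe k) -EFinM (bigD1 k)//= mulrC.
Qed.
End indep.

(** * Means and Taylor expansions *)

Section has_mean.
Context d (Omega : measurableType d) (R : realType) (P : probability Omega R).
Implicit Types (f g : Omega -> R) (m n : R).

(** Integrability and value of the integral travel together, so that means of
    polynomial expressions are computed by composing the lemmas below. *)
Definition has_mean f m :=
  P.-integrable setT (EFin \o f) /\ (\int[P]_w (f w)%:E = m%:E)%E.

Lemma has_mean_expectation f m : has_mean f m -> ('E_P[f] = m%:E)%E.
Proof. by case=> _ fm; rewrite unlock. Qed.

Lemma eq_has_mean f g m : f =1 g -> has_mean f m -> has_mean g m.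
Proof. by move=> /funext ->. Qed.

Lemma ge0_has_mean f m : measurable_fun setT f -> (forall w, 0 <= f w) ->
  (\int[P]_w (f w)%:E = m%:E)%E -> has_mean f m.
Proof.
move=> mf f0 fm; split => //; apply/integrableP; split.
  exact/measurable_EFinP.
under eq_integral do rewrite /= ger0_norm//.
by rewrite fm ltry.
Qed.

Lemma has_mean_cst m : has_mean (cst m) m.
Proof.
split; first exact: finite_measure_integrable_cst.
by rewrite [LHS](integral_cst P measurableT m%:E) /= probability_setT mule1.
Qed.

Lemma has_meanD f g m n : has_mean f m -> has_mean g n ->
  has_mean (fun w => f w + g w) (m + n).
Proof.
move=> [fi fm] [gi gn]; split.
  by apply: eq_integrable (integrableD _ fi gi) => // w _.
under eq_integral do rewrite EFinD.
by rewrite integralD//= fm gn.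
Qed.

Lemma has_meanZ a f m : has_mean f m -> has_mean (fun w => a * f w) (a * m).
Proof.
move=> [fi fm]; split.
  by apply: eq_integrable (integrableZl _ a fi) => // w _.
under eq_integral do rewrite EFinM.
by rewrite integralZl//= fm.
Qed.

Lemma has_meanN f m : has_mean f m -> has_mean (fun w => - f w) (- m).
Proof.
move=> fm; rewrite -mulN1r; apply: eq_has_mean (has_meanZ (-1) fm) => w.
by rewrite mulN1r.
Qed.

Lemma has_meanB f g m n : has_mean f m -> has_mean g n ->
  has_mean (fun w => f w - g w) (m - n).
Proof. by move=> fm gn; apply: has_meanD => //; exact: has_meanN. Qed.

Lemma has_mean_sum (I : Type) (s : seq I) (Q : pred I) (F : I -> Omega -> R)
    (M : I -> R) : (forall i, has_mean (F i) (M i)) ->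
  has_mean (fun w => \sum_(i <- s | Q i) F i w) (\sum_(i <- s | Q i) M i).
Proof.
move=> FM; elim: s => [|i s IHs].
  rewrite big_nil; apply: eq_has_mean (has_mean_cst 0) => w.
  by rewrite big_nil.
rewrite big_cons; case: ifP => Qi.
  by apply: eq_has_mean (has_meanD (FM i) IHs) => w; rewrite big_cons Qi.
by apply: eq_has_mean IHs => w; rewrite big_cons Qi.
Qed.

Lemma le_has_mean f g m n : has_mean f m -> has_mean g n ->
  (forall w, f w <= g w) -> m <= n.
Proof.
move=> [fi fm] [gi gn] fg; rewrite -lee_fin -fm -gn.
by apply: le_integral => // w _; rewrite lee_fin.
Qed.

Lemma dominated_has_mean f g n : measurable_fun setT f -> has_mean g n ->
  (forall w, `|f w| <= g w) -> exists m, has_mean f m.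
Proof.
move=> mf [gi gn] fg.
have fi : P.-integrable setT (EFin \o f).
  apply: le_integrable gi => //; first exact/measurable_EFinP.
  by move=> w _; rewrite lee_fin/= (le_trans (fg w))// ler_norm.
exists (fine (\int[P]_w (f w)%:E)%E); split => //.
by rewrite fineK// integrable_fin_num.
Qed.

End has_mean.

Section taylor.
Context (R : realType).
Implicit Types (t x y : R).

Lemma ge0_expR_partial y n : 0 <= y -> series (exp_coeff y) n <= expR y.
Proof.
move=> y0; rewrite /expR; apply: nondecreasing_cvgn_le.
  by apply: nondecreasing_series => k _ _; exact: exp_coeff_ge0.
exact: is_cvg_series_exp_coeff.
Qed.

Lemma ge0_expR_monomial y n : 0 <= y -> y ^+ n / n`!%:R <= expR y.
Proof.
move=> y0; apply: le_trans (ge0_expR_partial n.+1 y0).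
rewrite /series /= big_nat_recr//= /exp_coeff /= lerDr.
by apply: sumr_ge0 => i _; exact: exp_coeff_ge0.
Qed.

(** The tail of the series starts at degree [n], so that [t ^+ n] factors out of
    it when [`|t| <= 1]. The remainder is thus uniform in [y] up to [expR `|y|],
    which is integrable for a Gaussian [y]. *)
Lemma expR_taylor t y n : `|t| <= 1 ->
  `|expR (t * y) - \sum_(k < n) (t * y) ^+ k / k`!%:R| <= `|t| ^+ n * expR `|y|.
Proof.
move=> t1; pose u := series (exp_coeff (t * y)).
have uE m : u m = \sum_(k < m) (t * y) ^+ k / k`!%:R.
  by rewrite /u /series /= big_mkord; apply: eq_bigr => k _.
rewrite -uE.
have cu : u m @[m --> \oo] --> expR (t * y) by exact: is_cvg_series_exp_coeff.
have cv : `|u m - u n| @[m --> \oo] --> `|expR (t * y) - u n|.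
  by apply: cvg_norm; apply: cvgB => //; exact: cvg_cst.
apply: (cvgr_to_le cv); near=> m.
have nm : (n <= m)%N by near: m; exists n.
have /= -> : u m - u n = \sum_(n <= k < m) exp_coeff (t * y) k.
  by rewrite /u /series /= (big_cat_nat (n := n))//= addrAC subrr add0r.
apply: le_trans (ler_norm_sum _ _ _) _.
apply: (@le_trans _ _ (\sum_(n <= k < m) `|t| ^+ n * exp_coeff `|y| k)).
  rewrite big_nat [leRHS]big_nat; apply: ler_sum => k /andP[nk _].
  rewrite /exp_coeff /= normrM normrX normrM exprMn normfV [`|_%:R|]ger0_norm//.
  rewrite mulrA ler_wpM2r// ler_wpM2r ?exprn_ge0//.
  by apply: ler_wiXn2l.
rewrite -mulr_sumr ler_wpM2l ?exprn_ge0//.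
apply: le_trans (ge0_expR_partial m (normr_ge0 y)).
rewrite /series /= [leRHS](big_cat_nat (n := n))//= lerDr.
by apply: sumr_ge0 => k _; exact: exp_coeff_ge0.
Unshelve. all: by end_near. Qed.

Lemma small_multiple_eq0 x K : (forall t, 0 < t <= 1 -> `|x| <= K * t) -> x = 0.
Proof.
move=> xK; apply/eqP; rewrite -normr_le0 leNgt; apply/negP => x0.
have K0 : 0 < K.
  by have := xK 1; rewrite ltr01 lexx mulr1 => /(_ isT); exact: lt_le_trans.
have t0 : 0 < `|x| / (`|x| + 2 * K) by rewrite divr_gt0// addr_gt0// mulr_gt0.
have := xK (`|x| / (`|x| + 2 * K)).
have xK0 : 0 < `|x| + 2 * K by rewrite addr_gt0// mulr_gt0.
rewrite t0/= ler_pdivrMr// mul1r lerDl => /(_ (mulr_ge0 _ (ltW K0))).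
rewrite ler0n mulrA ler_pdivlMr// => /(_ isT).
nra.
Qed.

(** The even and odd parts are separated by comparing [t] and [- t]; each
    coefficient is then smaller than every multiple of [t]. *)
Lemma cubic_le_quartic_eq0 (a b c C : R) :
  (forall t, `|t| <= 1 -> `|a * t + b * t ^+ 2 + c * t ^+ 3| <= C * t ^+ 4) ->
  [/\ a = 0, b = 0 & c = 0].
Proof.
move=> H.
have H1 t : 0 < t <= 1 ->
    `|b| <= C * t ^+ 2 /\ `|a + c * t ^+ 2| <= C * t ^+ 3.
  move=> /andP[t0 t1]; have nt : `|t| <= 1 by rewrite ger0_norm// ltW.
  have h1 := H t nt; have h2 := H (- t); rewrite normrN in h2.
  have {}h2 := h2 nt; move: h1 h2; rewrite !ler_norml.
  have -> : a * - t + b * (- t) ^+ 2 + c * (- t) ^+ 3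
    = - (a * t) + b * t ^+ 2 - c * t ^+ 3 by ring.
  rewrite (_ : (- t) ^+ 4 = t ^+ 4); last by ring.
  have t2 : 0 < t ^+ 2 by rewrite exprn_gt0.
  move=> /andP[h1 h2] /andP[h3 h4].
  split.
    apply/andP; split; rewrite -(ler_pM2r t2); lra.
  apply/andP; split; rewrite -(ler_pM2r t0); lra.
have sq t : 0 < t <= 1 -> t ^+ 2 <= t.
  by move=> /andP[t0 t1]; rewrite expr2 ler_piMr// ltW.
have C0 : 0 <= C.
  have := H 1; rewrite normr1 lexx => /(_ isT); rewrite !expr1n !mulr1.
  exact: le_trans (normr_ge0 _).
have b0 : b = 0.
  apply: (@small_multiple_eq0 b C) => t t01; have [h _] := H1 t t01.
  by apply: le_trans h _; rewrite ler_wpM2l ?sq.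
have a0 : a = 0.
  apply: (@small_multiple_eq0 a (C + `|c|)) => t t01; have [_ h] := H1 t t01.
  have := sq t t01; case/andP: t01 => t0 t1 t2.
  have -> : a = (a + c * t ^+ 2) - c * t ^+ 2 by rewrite addrK.
  apply: le_trans (ler_normB _ _) _; rewrite mulrDl lerD//.
    apply: le_trans h _; rewrite ler_wpM2l// exprSr.
    apply: le_trans (_ : t ^+ 2 * 1 <= _); last by rewrite mulr1.
    by rewrite ler_wpM2l// exprn_ge0// ltW.
  by rewrite normrM ler_wpM2l// ger0_norm// exprn_ge0// ltW.
split=> //.
apply: (@small_multiple_eq0 c C) => t t01; have [_] := H1 t t01.
case/andP: t01 => t0 t1; have t2 : 0 < t ^+ 2 by rewrite exprn_gt0.
rewrite a0 add0r normrM [`|t ^+ 2|]ger0_norm ?exprn_ge0 ?(ltW t0)// => h.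
by rewrite -(ler_pM2r t2); apply: le_trans h _; rewrite -mulrA -exprS.
Qed.

End taylor.

Section moments.
Context d (Omega : measurableType d) (R : realType) (P : probability Omega R).

(** Compare the Taylor expansions in [t] of both sides of the hypothesis: they
    agree up to [t ^+ 4], so that the coefficients of degree 2 and 3 agree. *)
Lemma moments_of_gaussian_mgf (L : Omega -> R) (v : R) :
  measurable_fun setT L ->
  (forall t, has_mean P (fun w => expR (t * L w)) (expR (t ^+ 2 * v / 2))) ->
  has_mean P (fun w => L w ^+ 2) v /\ has_mean P (fun w => L w ^+ 3) 0.
Proof.
move=> mL mgf.
pose B w := expR (L w) + expR (- L w).
have [EB hB] : exists EB, has_mean P B EB.
  exists (expR (1 ^+ 2 * v / 2) + expR ((-1) ^+ 2 * v / 2)).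
  by apply: eq_has_mean (has_meanD (mgf 1) (mgf (-1))) => w;
    rewrite mul1r mulN1r.
have expB w : expR `|L w| <= B w.
  rewrite /B; case: (ger0P (L w)) => _.
    by rewrite lerDl expR_ge0.
  by rewrite lerDr expR_ge0.
have mom k : exists m, has_mean P (fun w => L w ^+ k) m.
  apply: (dominated_has_mean _ (has_meanZ k`!%:R hB)).
    exact: measurable_funX.
  move=> w; rewrite normrX -ler_pdivrMl ?ltr0n ?fact_gt0//.
  rewrite mulrC; apply: le_trans (expB w).
  exact: ge0_expR_monomial.
have [m1 h1] := mom 1%N; have [m2 h2] := mom 2%N; have [m3 h3] := mom 3%N.
suff [_ v0 m30] : [/\ m1 = 0, (m2 - v) / 2 = 0 & m3 / 6 = 0].
  have -> : v = m2 by lra.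
  by split => //; have <- : m3 = 0 by lra.
apply: (@cubic_le_quartic_eq0 _ _ _ _ (EB + expR `|v / 2|)) => t t1.
pose q w := 1 + t * L w ^+ 1 + t ^+ 2 / 2 * L w ^+ 2 + t ^+ 3 / 6 * L w ^+ 3.
have hq : has_mean P q (1 + t * m1 + t ^+ 2 / 2 * m2 + t ^+ 3 / 6 * m3).
  apply: has_meanD (has_meanZ _ h3); apply: has_meanD (has_meanZ _ h2).
  by apply: has_meanD (has_meanZ _ h1); exact: has_mean_cst.
have t40 : 0 <= t ^+ 4 by rewrite exprn_even_ge0.
have qE w : `|expR (t * L w) - q w| <= t ^+ 4 * B w.
  have := expR_taylor (L w) 4 t1.
  rewrite !big_ord_recr big_ord0 /= add0r expr0 !factS fact0 -normrX.
  rewrite [`|t ^+ 4|]ger0_norm//.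
  move=> h; apply: (@le_trans _ _ (t ^+ 4 * expR `|L w|)); last first.
    by rewrite ler_wpM2l.
  apply: le_trans h; rewrite le_eqVlt; apply/orP; left; apply/eqP; congr `|_|.
  by rewrite /q; field.
have dq := has_meanB (mgf t) hq.
have hub := le_has_mean dq (has_meanZ (t ^+ 4) hB)
  (fun w => le_trans (ler_norm _) (qE w)).
have hlb := le_has_mean (has_meanN dq) (has_meanZ (t ^+ 4) hB)
  (fun w => le_trans (ler_norm _) (eq_ind_r (fun x => x <= _) (qE w) (normrN _))).
have t21 : `|t ^+ 2| <= 1 by rewrite normrX exprn_ile1.
have := expR_taylor (v / 2) 2 t21.
rewrite !big_ord_recr big_ord0 /= add0r expr0 !factS fact0 -normrX.
rewrite -exprM [`|t ^+ (2 * 2)|]ger0_norm// expr1 mulrA ler_norml => /andP[g1 g2].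
rewrite ler_norml; apply/andP; split; lra.
Qed.

End moments.

Section linear_forms.
Context d (Omega : measurableType d) (R : realType) (P : probability Omega R).
Context (I : finType) (Z : I -> {RV P >-> R}).
Hypothesis iidZ : iid_standard_normal Z.

(** Linear forms in the Gaussian variables are Gaussian. Working with them avoids
    any case distinction on coinciding indices in mixed moments. *)
Definition linform (a : I -> R) (w : Omega) : R := \sum_i a i * Z i w.

Lemma measurable_linform a : measurable_fun setT (linform a).
Proof. by apply: measurable_sum => i; exact: measurable_funM. Qed.

Lemma linform_mgf a :
  has_mean P (fun w => expR (linform a w)) (expR ((\sum_i a i ^+ 2) / 2)).
Proof.
have mexp (c : R) : measurable_fun setT (fun x : R => expR (c * x)).
  by apply: measurableT_comp => //; exact: measurable_funM.
apply: ge0_has_mean.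
- by apply: measurableT_comp => //; exact: measurable_linform.
- by move=> w; exact: expR_ge0.
under eq_integral do rewrite expR_sum.
rewrite mulr_suml expR_sum.
apply: (@integral_prod_indep _ _ _ _ _ _ iidZ.1
  (fun i x => expR (a i * x)) (fun i => expR (a i ^+ 2 / 2))) => //.
move=> i; rewrite -(@normal_mgf _ (distribution P (Z i))); last exact: iidZ.2.
by rewrite ge0_integral_distribution//; exact/measurable_EFinP.
Qed.

Lemma linform_scale t a w : linform (fun i => t * a i) w = t * linform a w.
Proof. by rewrite /linform mulr_sumr; apply: eq_bigr => i _; rewrite mulrA. Qed.

Lemma linformD a b w : linform (fun i => a i + b i) w = linform a w + linform b w.
Proof. by rewrite /linform -big_split; apply: eq_bigr => i _; rewrite mulrDl. Qed.

Lemma linform_moments a :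
  has_mean P (fun w => linform a w ^+ 2) (\sum_i a i ^+ 2) /\
  has_mean P (fun w => linform a w ^+ 3) 0.
Proof.
apply: moments_of_gaussian_mgf; first exact: measurable_linform.
move=> t; rewrite mulr_sumr; under eq_bigr do rewrite -exprMn.
by apply: eq_has_mean (linform_mgf (fun i => t * a i)) => w;
  rewrite linform_scale.
Qed.

(** Polarisation: a product of three linear forms is a combination of four cubes
    of linear forms, each of mean zero. *)
Lemma linform3_mean a b c :
  has_mean P (fun w => linform a w * linform b w * linform c w) 0.
Proof.
pose L s t := linform (fun i => a i + (s * b i + t * c i)).
have LE s t w : L s t w = linform a w + (s * linform b w + t * linform c w).
  by rewrite /L !linformD !linform_scale.
have H s t : has_mean P (fun w => L s t w ^+ 3) 0 by exact: (linform_moments _).2.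
have := has_meanZ (24^-1)
  (has_meanB (has_meanD (H 1 1) (H (-1) (-1))) (has_meanD (H 1 (-1)) (H (-1) 1))).
rewrite addr0 subrr mulr0; apply: eq_has_mean => w.
by rewrite !LE; field.
Qed.

End linear_forms.

(** * Fourth moment of the operator norm of a Gaussian matrix *)

Section spectral_moment.
Context (R : realType).

(** Beyond [k], [x ^+ 4 <= 8 * (k ^+ 4 + (x - k) ^+ 4)] and the last power is at
    most [4`!] times the exponential. *)
Lemma quartic_le_expR (x k : R) : 0 <= x -> 0 <= k ->
  x ^+ 4 <= 8 * k ^+ 4 + 192 * expR (x - k).
Proof.
move=> x0 k0; have e0 := expR_gt0 (x - k).
have [xk|kx] := leP x k.
  have : x ^+ 4 <= k ^+ 4 by rewrite lerXn2r ?nnegrE.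
  have : 0 <= k ^+ 4 by rewrite exprn_ge0.
  lra.
have yE : x = k + (x - k) by rewrite addrC subrK.
have y0 : 0 <= x - k by rewrite subr_ge0 ltW.
have := ge0_expR_monomial 4 y0.
rewrite !factS fact0 ler_pdivrMr//= => h.
have -> : x ^+ 4 = (k + (x - k)) ^+ 4 by rewrite -yE.
move: (x - k) y0 h e0 {yE kx} => y y0 h e0.
have h1 : (k + y) ^+ 2 <= 2 * (k ^+ 2 + y ^+ 2).
  have := sqr_ge0 (k - y); lra.
have h2 : ((k + y) ^+ 2) ^+ 2 <= (2 * (k ^+ 2 + y ^+ 2)) ^+ 2.
  by rewrite lerXn2r ?nnegrE ?mulr_ge0 ?addr_ge0 ?sqr_ge0.
rewrite -exprM in h2; apply: le_trans h2 _.
have := sqr_ge0 (k ^+ 2 - y ^+ 2); lra.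
Qed.

(** Chosen so that [expR kap] exceeds [2 ^+ 8 * 16 * expR (1 / 2)], the growth rate
    per dimension of [2 ^+ (8 * D) * grid_mgf]. *)
Let kap : R := 2 ^+ 12 * expR (1 / 2).

Let kap_ge0 : 0 <= kap.
Proof. by apply: mulr_ge0; [exact: exprn_ge0 | exact: expR_ge0]. Qed.

Definition spectral_const : R := 16 * (8 * kap ^+ 4 + 192).

Lemma spectral_const_gt0 : 0 < spectral_const.
Proof.
rewrite mulr_gt0// ltr_wpDl//.
by rewrite mulr_ge0// exprn_ge0.
Qed.

Context d (Omega : measurableType d) (P : probability Omega R).
Context (m1 m2 D : nat) (Z : 'I_m1 * 'I_m2 -> {RV P >-> R}).
Hypothesis iidZ : iid_standard_normal Z.
Hypotheses (D0 : (0 < D)%N) (m1D : (m1 <= D)%N) (m2D : (m2 <= D)%N).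

Notation grid1 := {ffun 'I_m1 -> bool * 'I_(4 * m1).+1}.
Notation grid2 := {ffun 'I_m2 -> bool * 'I_(4 * m2).+1}.

Lemma bil_linform x y w :
  bil (random_mx Z w) x y = linform Z (fun p => x p.1 * y p.2) w.
Proof.
rewrite /bil /linform pair_bigA /=; apply: eq_bigr => -[i j] _ /=.
by rewrite mxE mulrAC.
Qed.

Definition in_ball m (k : {ffun 'I_m -> bool * 'I_(4 * m).+1}) : bool :=
  sqnorm (grid_point R k) <= 1.

(** A weighted sum, over pairs of grid points of the unit balls, of the
    exponential moments of the bilinear form. Unlike the operator norm it is
    plainly measurable, and its mean is a sum of Gaussian moment generating
    functions. *)
Definition grid_mgf (w : Omega) : R :=
  \sum_(k : grid1 | in_ball k) \sum_(l : grid2 | in_ball l)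
    grid_weight R k * grid_weight R l *
    expR (Num.sqrt D%:R * bil (random_mx Z w) (grid_point R k) (grid_point R l)).

Lemma grid_mgf_mean :
  exists2 b, has_mean P grid_mgf b & b <= 16 ^+ D * expR (D%:R / 2).
Proof.
pose e (k : grid1) (l : grid2) : R := expR ((\sum_(p : 'I_m1 * 'I_m2)
  (Num.sqrt D%:R * (grid_point R k p.1 * grid_point R l p.2)) ^+ 2) / 2).
exists (\sum_(k : grid1 | in_ball k) \sum_(l : grid2 | in_ball l)
    grid_weight R k * grid_weight R l * e k l).
  apply: has_mean_sum => k; apply: has_mean_sum => l; apply: has_meanZ.
  apply: eq_has_mean (linform_mgf iidZ _) => w.
  by rewrite linform_scale -bil_linform.
apply: (@le_trans _ _ (\sum_(k : grid1) \sum_(l : grid2)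
    grid_weight R k * grid_weight R l * expR (D%:R / 2))).
  have w0 (k : grid1) (l : grid2) :
      0 <= grid_weight R k * grid_weight R l * expR (D%:R / 2).
    by rewrite mulr_ge0 ?expR_ge0// mulr_ge0 ?ltW ?grid_weight_gt0.
  rewrite big_mkcond; apply: ler_sum => k _; case: ifPn => [k1|_]; last first.
    by apply: sumr_ge0 => l _.
  rewrite big_mkcond; apply: ler_sum => l _; case: ifPn => [l1|_] //.
  rewrite ler_wpM2l ?mulr_ge0 ?(ltW (grid_weight_gt0 _ _))//.
  rewrite ler_expR ler_wpM2r ?invr_ge0//.
  have -> : \sum_(p : 'I_m1 * 'I_m2)
      (Num.sqrt D%:R * (grid_point R k p.1 * grid_point R l p.2)) ^+ 2 =
      D%:R * (sqnorm (grid_point R k) * sqnorm (grid_point R l)).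
    rewrite /sqnorm mulr_suml mulr_sumr.
    under [RHS]eq_bigr do rewrite mulr_sumr mulr_sumr.
    rewrite pair_bigA /=; apply: eq_bigr => p _.
    by rewrite !exprMn sqr_sqrtr.
  rewrite -[leRHS]mulr1 ler_wpM2l// mulr_ile1//; exact: sqnorm_ge0.
under eq_bigr do rewrite -mulr_suml -mulr_sumr.
rewrite -mulr_suml -mulr_suml ler_wpM2r ?expR_ge0//.
have -> : (16 : R) ^+ D = 4 ^+ D * 4 ^+ D by rewrite -exprMn; congr (_ ^+ _); ring.
have w0 m : 0 <= \sum_(k : {ffun 'I_m -> bool * 'I_(4 * m).+1}) grid_weight R k.
  by apply: sumr_ge0 => k _; rewrite ltW// grid_weight_gt0.
have le4 m : (m <= D)%N ->
    \sum_(k : {ffun 'I_m -> bool * 'I_(4 * m).+1}) grid_weight R k <= 4 ^+ D.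
  move=> mD; apply: le_trans (sum_grid_weight _ _) _.
  by rewrite ler_weXn2l// ler1n.
by apply: ler_pM => //; exact: le4.
Qed.

(** A measurable random variable of mean [O(D ^+ 2)] that dominates the fourth
    power of the operator norm of the noise. *)
Definition spectral_bound (w : Omega) : R :=
  16 / D%:R ^+ 2 * (8 * (kap * D%:R) ^+ 4 +
    192 * (expR (- (kap * D%:R)) * (2 ^+ (8 * D) * grid_mgf w))).

(** The constant [kap] makes the exponential factor beat the growth of [grid_mgf]. *)
Lemma spectral_bound_mean :
  exists2 b, has_mean P spectral_bound b & b <= spectral_const * D%:R ^+ 2.
Proof.
have [b hb b16] := grid_mgf_mean.
exists (16 / D%:R ^+ 2 * (8 * (kap * D%:R) ^+ 4 +
    192 * (expR (- (kap * D%:R)) * (2 ^+ (8 * D) * b)))).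
  apply: has_meanZ; apply: has_meanD; first exact: has_mean_cst.
  by do 3 apply: has_meanZ.
have Dr : 0 < D%:R :> R by rewrite ltr0n.
rewrite mulrAC ler_pdivrMr ?exprn_gt0//.
rewrite /spectral_const -!(mulrA 16) ler_wpM2l//.
rewrite -[leRHS]mulrA -exprD.
have small : expR (- (kap * D%:R)) * (2 ^+ (8 * D) * b) <= 1.
  rewrite expRN ler_pdivrMl ?expR_gt0// mulr1.
  apply: (@le_trans _ _ (kap ^+ D)).
    apply: (@le_trans _ _ (2 ^+ (8 * D) * (16 ^+ D * expR (D%:R / 2)))).
      by rewrite ler_wpM2l// exprn_ge0.
    rewrite exprM mulrA -exprMn /kap [leRHS]exprMn -expRM_natr mulrAC mul1r.
    rewrite [_ / 2]mulrC le_eqVlt; apply/orP; left; apply/eqP.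
    by rewrite [2^-1 * _]mulrC; congr (_ ^+ _ * _); ring.
  rewrite expRM_natr lerXn2r ?nnegrE ?expR_ge0//.
  by apply: le_trans (expR_ge1Dx kap); rewrite lerDr.
have D4 : 1 <= D%:R ^+ 4 :> R by rewrite exprn_ege1// ler1n.
rewrite exprMn; move: small D4; set u := expR _ * _; set v := D%:R ^+ 4.
move=> u1 v1; rewrite [leRHS]mulrDl -[8 * kap ^+ 4 * v]mulrA lerD2l ler_wpM2l//.
exact: le_trans v1.
Qed.

(** For a pair of points of the net, the exponential of [sqrt D] times the bilinear
    form is one term of [grid_mgf] up to the weight, at least [2 ^- (8 * D)];
    [quartic_le_expR] converts this into a bound on the fourth power, and
    [spectral_le_net] extends it to all unit vectors. *)
Lemma spectral_bound_le w :
  exists s, [/\ 0 <= s, spectral_le (random_mx Z w) s & s ^+ 4 <= spectral_bound w].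
Proof.
have Dr : 0 < D%:R :> R by rewrite ltr0n.
set q := Num.sqrt (D%:R : R).
have q0 : 0 < q by rewrite sqrtr_gt0.
have qq : q ^+ 2 = D%:R by rewrite sqr_sqrtr// ltW.
have G0 : 0 <= grid_mgf w.
  apply: sumr_ge0 => k _; apply: sumr_ge0 => l _.
  by rewrite !mulr_ge0 ?expR_ge0 ?(ltW (grid_weight_gt0 _ _)).
set B := spectral_bound w.
have B0 : 0 <= B.
  rewrite mulr_ge0 ?divr_ge0 ?exprn_ge0// addr_ge0// mulr_ge0 ?exprn_ge0//.
    by rewrite mulr_ge0// ltW.
  by rewrite mulr_ge0 ?expR_ge0// mulr_ge0// exprn_ge0.
pose s := Num.sqrt (Num.sqrt B).
have s4 : s ^+ 4 = B.
  by rewrite (exprM s 2 2) sqr_sqrtr ?sqrtr_ge0// sqr_sqrtr.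
exists s; split; [exact: sqrtr_ge0| |by rewrite s4].
have -> : s = 2 * (s / 2) by field.
pose N m : set ('I_m -> R) := [set x |
  exists k : {ffun 'I_m -> bool * 'I_(4 * m).+1},
  [/\ x = grid_point R k, in_ball k & 2^-1 ^+ (4 * m) <= grid_weight R k]].
have NE m (v : 'I_m -> R) : sqnorm v <= 1 ->
    exists2 x, N m x & sqnorm (fun i => v i - x i) <= 16^-1.
  move=> v1; have [k [k1 kw kv]] := grid_net v1.
  by exists (grid_point R k) => //; exists k.
apply: (@spectral_le_net _ _ _ _ (N m1) (N m2)).
- by move=> _ [k [-> + _]].
- by move=> _ [k [-> + _]].
- exact: NE.
- exact: NE.
move=> _ _ [k [-> k1 kw]] [l [-> l1 lw]].
set y := bil _ _ _.
have s0 : 0 <= s by exact: sqrtr_ge0.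
have [y0|y0] := leP y 0; first by apply: le_trans y0 _; rewrite divr_ge0.
have expy : expR (q * y) <= 2 ^+ (8 * D) * grid_mgf w.
  have le_term : grid_weight R k * grid_weight R l * expR (q * y) <= grid_mgf w.
    rewrite /grid_mgf (bigD1 k)//= (bigD1 l)//= -/q -/y -addrA lerDl addr_ge0//.
      apply: sumr_ge0 => l' _.
      by rewrite !mulr_ge0 ?expR_ge0 ?(ltW (grid_weight_gt0 _ _)).
    apply: sumr_ge0 => k' _; apply: sumr_ge0 => l' _.
    by rewrite !mulr_ge0 ?expR_ge0 ?(ltW (grid_weight_gt0 _ _)).
  have half m : (m <= D)%N -> (2^-1 : R) ^+ (4 * D) <= 2^-1 ^+ (4 * m).
    move=> mD; apply: ler_wiXn2l; rewrite ?invr_ge0 ?invf_le1 ?ler1n//.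
    by rewrite leq_mul2l mD orbT.
  have ww : (2 ^+ (8 * D))^-1 <= grid_weight R k * grid_weight R l.
    have -> : (2 ^+ (8 * D))^-1 = 2^-1 ^+ (4 * D) * 2^-1 ^+ (4 * D) :> R.
      by rewrite -exprD -mulnDl exprVn.
    apply: ler_pM; rewrite ?exprn_ge0 ?invr_ge0//.
      exact: le_trans (half _ m1D) kw.
    exact: le_trans (half _ m2D) lw.
  rewrite -ler_pdivrMl ?exprn_gt0//; apply: le_trans le_term.
  by rewrite ler_wpM2r ?expR_ge0.
have kD0 : 0 <= kap * D%:R by rewrite mulr_ge0// ltW.
have := quartic_le_expR (mulr_ge0 (ltW q0) (ltW y0)) kD0.
rewrite [_ - kap * _]addrC expRD => h.
rewrite -(@ler_pXn2r _ 4) ?nnegrE ?divr_ge0 ?(ltW y0)//.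
rewrite expr_div_n s4 -(@ler_pM2l _ (D%:R ^+ 2)) ?exprn_gt0//.
rewrite -{1}qq -exprM -exprMn; apply: le_trans h _.
rewrite /B /spectral_bound.
have -> : D%:R ^+ 2 * (16 / D%:R ^+ 2 * (8 * (kap * D%:R) ^+ 4 +
    192 * (expR (- (kap * D%:R)) * (2 ^+ (8 * D) * grid_mgf w))) / 2 ^+ 4) =
    8 * (kap * D%:R) ^+ 4 +
    192 * (expR (- (kap * D%:R)) * (2 ^+ (8 * D) * grid_mgf w)).
  by move: (expR _) (_ * grid_mgf w) => ? ?; field; rewrite gt_eqF.
by rewrite lerD2l ler_wpM2l// ler_wpM2l ?expR_ge0.
Qed.

End spectral_moment.

(** * Expectations *)

Section sandwich.
Context d (Omega : measurableType d) (R : realType) (P : probability Omega R).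

(** The integral of a nonnegative function is a supremum over the simple functions
    below it, hence monotone whether or not the function is measurable. *)
Lemma ge0_expectation_le (f g : Omega -> R) :
  (forall w, 0 <= f w) -> (forall w, f w <= g w) -> ('E_P[f] <= 'E_P[g])%E.
Proof.
move=> f0 fg; rewrite unlock.
have g0 w : 0 <= g w by exact: le_trans (fg w).
rewrite !ge0_integralTE; [|by move=> w; rewrite lee_fin..].
apply: le_ereal_sup => _ [h hf <-]; exists h => //= w.
by apply: le_trans (hf w) _; rewrite lee_fin.
Qed.

(** Singular vectors can be chosen arbitrarily where the singular values of ranks
    [r] and [r + 1] coincide, so the distance may fail to be measurable; its
    expectation is controlled by squeezing it between measurable functions. *)
Lemma expectation_sandwich (f g b : Omega -> R) (m n : R) :
  (forall w, 0 <= f w) -> has_mean P g m -> has_mean P b n ->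
  (forall w, `|f w - g w| <= b w) -> (`|'E_P[f] - m%:E| <= n%:E)%E.
Proof.
move=> f0 gm bn fgb.
have [gi _] := gm; have [bi _] := bn.
have mgb : measurable_fun setT (fun w => Num.max (g w - b w) 0).
  apply: measurable_maxr => //; apply: measurable_funB; apply/measurable_EFinP.
    exact: measurable_int gi.
  exact: measurable_int bi.
have hgb := has_meanB gm bn.
have hgB := has_meanD gm bn.
have upp : ('E_P[f] <= (m + n)%:E)%E.
  rewrite -(has_mean_expectation hgB); apply: ge0_expectation_le => // w.
  by have := fgb w; rewrite ler_norml; lra.
(* The positive part of the lower bound is used, so that monotonicity applies to
   nonnegative functions. *)
have [p hp] : exists p, has_mean P (fun w => Num.max (g w - b w) 0) p.
  have ni : P.-integrable setT (EFin \o (fun w => `|g w|)) by exact: integrable_norm.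
  apply: (@dominated_has_mean _ _ _ _ _ (fun w => `|g w|)
      (fine (\int[P]_w (`|g w|)%:E)%E)) => //.
    by split => //; rewrite fineK// integrable_fin_num.
  move=> w; rewrite ger0_norm ?le_max ?lexx ?orbT// ge_max normr_ge0 andbT.
  have := fgb w; have := normr_ge0 (f w - g w); have := ler_norm (g w); lra.
have low : (p%:E <= 'E_P[f])%E.
  rewrite -(has_mean_expectation hp); apply: ge0_expectation_le => w.
    by rewrite le_max lexx orbT.
  by rewrite ge_max f0 andbT; have := fgb w; rewrite ler_norml; lra.
have mp : m - n <= p.
  by apply: le_has_mean hgb hp _ => w; rewrite le_max lexx.
move: upp low; case: 'E_P[f]%E => [x| |]//; rewrite !lee_fin => h1 h2.
by rewrite ler_norml; apply/andP; split; lra.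
Qed.
End sandwich.

Section gaussian_expectations.
Context d (Omega : measurableType d) (R : realType) (P : probability Omega R).
Context (d1 d2 : nat) (Z : 'I_d1 * 'I_d2 -> {RV P >-> R}).
Hypothesis iidZ : iid_standard_normal Z.

(** The noise enters the first and second order terms through matrices with
    entries linear in the Gaussian variables. *)
Definition linear_entries m n (A : Omega -> 'M[R]_(m, n)) :=
  forall i j, exists a, forall w, A w i j = linform Z a w.

Lemma linform_lincomb (I : finType) (f : I -> Omega -> R) (c : I -> R) :
  (forall i, exists a, forall w, f i w = linform Z a w) ->
  exists a, forall w, \sum_i c i * f i w = linform Z a w.
Proof.
move=> /choice[a fa]; exists (fun p => \sum_i c i * a i p) => w.
rewrite /linform; under [RHS]eq_bigr do rewrite mulr_suml.
rewrite exchange_big; apply: eq_bigr => i _; rewrite fa /linform mulr_sumr.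
by apply: eq_bigr => p _; rewrite mulrA.
Qed.

Lemma linear_entries_mull m n p (C : 'M[R]_(p, m)) (A : Omega -> 'M[R]_(m, n)) :
  linear_entries A -> linear_entries (fun w => C *m A w).
Proof.
move=> Al i j.
have [a aE] := linform_lincomb (fun k => C i k) (fun k => Al k j).
by exists a => w; rewrite mxE.
Qed.

Lemma linear_entries_mulr m n p (C : 'M[R]_(n, p)) (A : Omega -> 'M[R]_(m, n)) :
  linear_entries A -> linear_entries (fun w => A w *m C).
Proof.
move=> Al i j.
have [a aE] := linform_lincomb (fun k => C k j) (fun k => Al i k).
exists a => w; rewrite mxE -aE; apply: eq_bigr => k _; exact: mulrC.
Qed.

Lemma linear_entries_dilation :
  linear_entries (fun w => dilation (random_mx Z w)).
Proof.
have lin0 : exists a, forall w, 0 = linform Z a w :> R.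
  by exists (fun=> 0) => w; rewrite /linform big1// => p _; rewrite mul0r.
have linZ i j : exists a, forall w, Z (i, j) w = linform Z a w.
  exists (fun p => (p == (i, j))%:R) => w; rewrite /linform (bigD1 (i, j))//=.
  by rewrite eqxx mul1r big1 ?addr0// => p /negPf ->; rewrite mul0r.
move=> i j; rewrite /dilation /block_mx.
case: (split_ordP i) => i' ->; case: (split_ordP j) => j' ->.
- have [a aE] := lin0; exists a => w.
  by rewrite col_mxEu row_mxEl mxE.
- have [a aE] := linZ i' j'; exists a => w.
  by rewrite col_mxEu row_mxEr mxE.
- have [a aE] := linZ j' i'; exists a => w.
  by rewrite col_mxEd row_mxEl !mxE.
- have [a aE] := lin0; exists a => w.
  by rewrite col_mxEd row_mxEr mxE.
Qed.

Lemma fip_cubic_mean m n p (A : Omega -> 'M[R]_(m, n)) (B : Omega -> 'M[R]_(m, p))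
    (C : Omega -> 'M[R]_(p, n)) :
  linear_entries A -> linear_entries B -> linear_entries C ->
  has_mean P (fun w => fip (A w) (B w *m C w)) 0.
Proof.
move=> Al Bl Cl.
have H i j k : has_mean P (fun w => A w i j * (B w i k * C w k j)) 0.
  have [a aE] := Al i j; have [b bE] := Bl i k; have [c cE] := Cl k j.
  apply: eq_has_mean (linform3_mean iidZ a b c) => w.
  by rewrite aE bE cE mulrA.
rewrite (_ : 0 = \sum_(i < m) \sum_(j < n) \sum_(k < p) 0 :> R); last first.
  by rewrite big1// => i _; rewrite big1// => j _; rewrite big1.
apply: (@eq_has_mean _ _ _ _
  (fun w => \sum_i \sum_j \sum_k A w i j * (B w i k * C w k j))) => [w|].
  rewrite fipE; apply: eq_bigr => i _; apply: eq_bigr => j _.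
  by rewrite mxE mulr_sumr.
by do 3 (apply: has_mean_sum => ?).
Qed.

(** The entries of [A *m Z *m B] are linear forms with coefficients products of
    entries of [A] and [B]. *)
Lemma fip_sandwich_mean m n (A : 'M[R]_(m, d1)) (B : 'M[R]_(d2, n)) :
  has_mean P (fun w => fip (A *m random_mx Z w *m B) (A *m random_mx Z w *m B))
    (fip A A * fip B B).
Proof.
pose a i j (p : 'I_d1 * 'I_d2) := A i p.1 * B p.2 j.
have -> : fip A A * fip B B = \sum_i \sum_j \sum_p a i j p ^+ 2.
  rewrite !fipE mulr_suml; apply: eq_bigr => i _.
  rewrite [X in _ * X]exchange_big mulr_sumr; apply: eq_bigr => j _.
  by rewrite big_distrlr pair_bigA /=; apply: eq_bigr => p _; rewrite /a /=; ring.
apply: (@eq_has_mean _ _ _ _ (fun w => \sum_i \sum_j linform Z (a i j) w ^+ 2)).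
  move=> w; rewrite fipE; apply: eq_bigr => i _; apply: eq_bigr => j _.
  rewrite -expr2; congr (_ ^+ 2); rewrite mxE.
  under eq_bigr do rewrite mxE mulr_suml.
  rewrite exchange_big pair_bigA; apply: eq_bigr => -[k l] _ /=.
  by rewrite mxE /a /=; ring.
apply: has_mean_sum => i; apply: has_mean_sum => j.
exact: (linform_moments iidZ _).1.
Qed.

Context (r : nat) (U : 'M[R]_(d1, r)) (lam : 'rV[R]_r) (V : 'M[R]_(d2, r)).
Hypothesis UU : U^T *m U = 1%:M.
Hypothesis VV : V^T *m V = 1%:M.
Hypothesis lam0 : forall i, lam 0 i != 0.

Local Notation X w := (dilation (random_mx Z w)).
Local Notation Pr := (block_proj U V).
Local Notation T := (frakP_inv U lam V).

Lemma fip_projC m (W : 'M[R]_(m, r)) : W^T *m W = 1%:M ->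
  fip (1%:M - W *m W^T) (1%:M - W *m W^T) = m%:R - r%:R.
Proof.
move=> WW; have [Qt QQ] := orth_projC (orth_proj_isometry WW).
by rewrite /fip Qt QQ linearB/= mxtrace1 mxtrace_mulC WW mxtrace1.
Qed.

(** The first order term is block diagonal, with blocks [Q1 Z S^T] and [Q2 Z^T S]
    for the complementary projectors [Q1] and [Q2] of ranks [d1 - r] and
    [d2 - r]. *)
Lemma first_order_mean :
  has_mean P (fun w => frobenius (first_order (X w) Pr T) ^+ 2)
    (dstar R d1 d2 r * frobenius (invmx (diag_mx lam)) ^+ 2).
Proof.
set S := svd_inv U lam V.
have SE : fip S S = frobenius (invmx (diag_mx lam)) ^+ 2.
  rewrite fip_svd_inv// sqr_frobenius invmx_diag// fipE.
  apply: eq_bigr => i _; rewrite (bigD1 i)//= big1 => [|j ji].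
    by rewrite !mxE eqxx mulr1n addr0 expr2.
  by rewrite !mxE eq_sym (negPf ji) mulr0n mul0r.
have St : fip S^T S^T = fip S S by rewrite -!sqr_frobenius frobenius_trmx.
have Qt m (W : 'M[R]_(m, r)) : (1%:M - W *m W^T)^T = 1%:M - W *m W^T.
  by rewrite linearB/= trmx1 trmx_mul trmxK.
have := has_meanD (fip_sandwich_mean (1%:M - U *m U^T) S^T)
  (fip_sandwich_mean S^T (1%:M - V *m V^T)).
rewrite St !fip_projC// SE.
rewrite (_ : _ + _ =
  dstar R d1 d2 r * frobenius (invmx (diag_mx lam)) ^+ 2); last first.
  by rewrite /dstar; ring.
apply: eq_has_mean => w; rewrite sqr_frobenius /first_order frakP_invE// -/S.
rewrite -(mulmxA _ (X w)) mul_dilation.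
have -> : 1%:M - Pr = block_mx (1%:M - U *m U^T) 0 0 (1%:M - V *m V^T).
  by rewrite /block_proj scalar_mx_block opp_block_mx add_block_mx !subr0.
rewrite mulmx_block !mul0mx !mulmx0 !addr0 !add0r fip_block_diag.
congr (_ + _); first by rewrite mulmxA.
rewrite -!sqr_frobenius -[in LHS]frobenius_trmx.
by rewrite (trmx_mul (S^T *m _)) (trmx_mul S^T) trmxK Qt.
Qed.

(** A cubic form in centred Gaussian variables has mean zero. *)
Lemma cross_term_mean :
  has_mean P (fun w => fip (first_order (X w) Pr T) (second_order (X w) Pr T)) 0.
Proof.
have Xl := linear_entries_dilation.
have QXl := linear_entries_mull (1%:M - Pr) Xl.
have F1l := linear_entries_mulr T QXl.
rewrite -[0](subrr 0).
apply: eq_has_mean (has_meanB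
  (fip_cubic_mean F1l QXl (linear_entries_mulr T F1l))
  (fip_cubic_mean F1l F1l (linear_entries_mulr T Xl))) => w.
by rewrite -fipNr -fipDr /second_order /first_order !mulmxA.
Qed.

End gaussian_expectations.

(** * Mean squared distance of singular subspaces *)

Theorem lemma1 (R : realType) :
  (forall (d : measure_display) (Omega : measurableType d)
          (P : probability Omega R) (d1 d2 r : nat) (M : 'M[R]_(d1, d2))
          (U : 'M[R]_(d1, r)) (lam : 'rV[R]_r) (V : 'M[R]_(d2, r))
          (Uperp : 'M[R]_(d1, d1 - r)) (Vperp : 'M[R]_(d2, d2 - r))
          (Z : 'I_d1 * 'I_d2 -> {RV P >-> R}),
     low_rank_model M U lam V ->
     orthogonal_mx (row_mx U Uperp) ->
     orthogonal_mx (row_mx V Vperp) ->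
     iid_standard_normal Z ->
     'E_P[(fun w => frobenius (frakP_perp Uperp Vperp *m
                      dilation (random_mx Z w) *m frakP_inv U lam V) ^+ 2)%R]%E
     = (dstar R d1 d2 r * frobenius (invmx (diag_mx lam)) ^+ 2)%:E)
  /\
  (exists C0 : R, 0 < C0 /\ forall C1 : R, C0 <= C1 ->
   exists C2 : R, 0 < C2 /\
   forall (d : measure_display) (Omega : measurableType d)
          (P : probability Omega R) (d1 d2 r : nat) (hr : (0 < r)%N)
          (M : 'M[R]_(d1, d2))
          (U : 'M[R]_(d1, r)) (lam : 'rV[R]_r) (V : 'M[R]_(d2, r))
          (Z : 'I_d1 * 'I_d2 -> {RV P >-> R})
          (Uhat : Omega -> 'M[R]_(d1, r)) (Vhat : Omega -> 'M[R]_(d2, r)),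
     low_rank_model M U lam V ->
     iid_standard_normal Z ->
     (forall w : Omega,
        top_singular_vectors (M + random_mx Z w) (Uhat w) (Vhat w)) ->
     C1 * Num.sqrt (maxn d1 d2)%:R <= lam 0 (last_idx hr) ->
     (`| 'E_P[fun w => dist2 (Uhat w) (Vhat w) U V]
         - (2 * dstar R d1 d2 r * frobenius (invmx (diag_mx lam)) ^+ 2)%:E |
      <= (C2 * r%:R * ((maxn d1 d2)%:R / lam 0 (last_idx hr) ^+ 2) ^+ 2)%:E)%E).
Proof.
split.
  move=> d Omega P d1 d2 r M U lam V Uperp Vperp Z [[ME UU VV ldec _] lam0]
    [_ UUp] [_ VVp] iidZ.
  have lamN i : lam 0 i != 0 by rewrite gt_eqF.
  have perpC m p (W : 'M[R]_(m, r)) (W' : 'M[R]_(m, p)) :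
      row_mx W W' *m (row_mx W W')^T = 1%:M -> W' *m W'^T = 1%:M - W *m W^T.
    by rewrite tr_row_mx mul_row_col => <-; rewrite addrC addKr.
  have perpE : frakP_perp Uperp Vperp = 1%:M - block_proj U V.
    rewrite /frakP_perp (perpC _ _ _ _ UUp) (perpC _ _ _ _ VVp).
    by rewrite /block_proj scalar_mx_block opp_block_mx add_block_mx !subr0.
  by rewrite perpE; apply: has_mean_expectation; exact: first_order_mean.
(* The second constant multiplies those of [dist2_expansion] and of
   [spectral_bound_mean]. *)
exists 1; split=> // C1 _; exists (2 ^+ 9 * spectral_const R); split.
  by rewrite mulr_gt0 ?exprn_gt0 ?spectral_const_gt0.
move=> d Omega P d1 d2 r hr M U lam V Z Uhat Vhat model iidZ top _.
have [[ME UU VV ldec _] lam0] := model.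
have lamN i : lam 0 i != 0 by rewrite gt_eqF.
set c := lam 0 (last_idx hr); set D := maxn d1 d2.
have c0 : 0 < c by exact: lam0.
have D0 : (0 < D)%N.
  rewrite (leq_trans _ (leq_maxl d1 d2))// lt0n; apply/negP => /eqP d10.
  have := congr1 (fun A : 'M[R]_r => A (last_idx hr) (last_idx hr)) UU.
  rewrite !mxE eqxx big1 => [/eqP|j _]; first by rewrite eq_sym oner_eq0.
  by have := ltn_ord j; rewrite {2}d10.
have [b hb bK] := spectral_bound_mean iidZ D0 (leq_maxl d1 d2) (leq_maxr d1 d2).
have hL := has_meanD (has_meanZ 2 (first_order_mean iidZ UU VV lamN))
  (has_meanZ 4 (cross_term_mean iidZ U lam V)).
rewrite mulr0 addr0 mulrA in hL.
have hB := has_meanZ (2 ^+ 9 * r%:R / c ^+ 4) hb.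
have dist0 w : 0 <= dist2 (Uhat w) (Vhat w) U V by rewrite addr_ge0// sqr_ge0.
apply: le_trans (expectation_sandwich dist0 hL hB _) _.
  move=> w; have [s [s0 Zs s4]] :=
    spectral_bound_le Z D0 (leq_maxl d1 d2) (leq_maxr d1 d2) w.
  rewrite opprD addrA; apply: le_trans (dist2_expansion hr model s0 Zs (top w)) _.
  rewrite -/c expr_div_n [2 ^+ 9 * r%:R / _ * _]mulrAC mulrA.
  by rewrite ler_wpM2r ?invr_ge0 ?exprn_ge0 ?(ltW c0)// ler_wpM2l.
rewrite lee_fin.
have -> : 2 ^+ 9 * spectral_const R * r%:R * (D%:R / c ^+ 2) ^+ 2 =
    2 ^+ 9 * r%:R / c ^+ 4 * (spectral_const R * D%:R ^+ 2).
  by field; rewrite gt_eqF.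
by rewrite ler_wpM2l ?divr_ge0 ?mulr_ge0 ?exprn_ge0 ?(ltW c0).
Qed.
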